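(* Let $\Gamma$ be a congruence subgroup, $S\subset\mathfrak H$ a finite union of $\Gamma$-orbits, $U=\mathfrak H\setminus S$, $A,B\subset V_{2k-2}$ $\Gamma$-invariant subgroups, and $\omega$ a smooth closed $\Gamma$-equivariant $V_{2k-2}$-valued $1$-form on $U$ whose integrals along small loops around points of $S$ lie in $A$. Let $z\in U$ and $v\in B$, and assume that the class of $\omega$ in $H^1(\Gamma,V_{2k-2}/A)$ is trivial and that the class of $v$ in $H_0(\Gamma,B)$ is trivial. Let $I$ be any invariant integral of $\omega$ modulo $A$, and write $v=\sum_{i=1}^n(\gamma_iu_i-u_i)$ with $\gamma_i\in\Gamma$, $u_i\in B$. Then \[ (I(z),v)\equiv\sum_{i=1}^n\Big(\int_z^{\gamma_i^{-1}z}\omega,\,u_i\Big)\pmod{(A,B)}, \] and this common value $I^{A,B,\Gamma}(\omega,z,v)\in\mathbb C/(A,B)$ is independent of the choice of $I$ and of the representation of $v$.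
   Context: $\mathfrak H$ is the upper half-plane. $V_{2k-2}$ is the space of complex polynomials in $X$ of degree $\le2k-2$, with left $SL_2(\mathbb R)$-action $\gamma p=p|\gamma^{-1}$, $(p|\gamma)(X)=p(\frac{aX+b}{cX+d})(cX+d)^{2k-2}$, and invariant pairing $(\sum p_iX^i,\sum q_iX^i)=\sum_i(-1)^ip_iq_{2k-2-i}/\binom{2k-2}i$; $(A,B)\subset\mathbb C$ is the subgroup generated by $(a,b)$, $a\in A,b\in B$. $\omega$ is $\Gamma$-equivariant if $\gamma^*\omega=\gamma\cdot\omega$ for $\gamma\in\Gamma$. Integrals $\int_a^b\omega$ are along paths in $U$ and are well defined modulo $A$. The class of $\omega$ in $H^1(\Gamma,V_{2k-2}/A)$ is that of the cocycle $\gamma\mapsto\int_a^{\gamma a}\omega\bmod A$ (independent of $a\in U$). $H_0(\Gamma,B)=B/\langle\gamma u-u:\gamma\in\Gamma,u\in B\rangle$. An invariant integral of $\omega$ modulo $A$ is a function $I\colon U\to V_{2k-2}/A$ which near each point is the reduction mod $A$ of a smooth function $h$ with $dh=\omega$, and satisfies $I(\gamma z)=\gamma I(z)$ for $\gamma\in\Gamma$. *)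

(* Defs.v *)
(* The real numbers are an arbitrary R : realType, the complex numbers R[i]. *)
From HB Require Import structures.
From mathcomp Require Import all_boot all_order all_algebra.
From mathcomp Require Import all_classical all_reals all_analysis.
From mathcomp Require Import complex.

Set Implicit Arguments.
Unset Strict Implicit.
Unset Printing Implicit Defensive.

Import Order.TTheory GRing.Theory Num.Theory numFieldNormedType.Exports.

Local Open Scope classical_set_scope.
Local Open Scope complex_scope.
Local Open Scope ring_scope.

Definition subgroup (M : zmodType) (G : set M) : Prop :=
  G 0 /\ forall x y, G x -> G y -> G (x - y).

Definition congr_mod (M : zmodType) (G : set M) (x y : M) : Prop := G (x - y).

Definition upper_half_plane (R : realType) : set R[i] :=
  [set z | 0 < complex.Im z].

Definition mobius (R : realType) (g : 'M[R]_2) (z : R[i]) : R[i] :=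
  ((g 0 0)%:C * z + (g 0 1)%:C) / ((g 1 0)%:C * z + (g 1 1)%:C).

(* [Vpoly R m] is the space V_m of polynomials of degree <= m. *)
Notation Vpoly R m := {poly_(m.+1) (complex R)}.

Section Action.
Context {R : realType} {m : nat}.
Implicit Types (p q : Vpoly R m) (g : 'M[R]_2).

(* p((aX+b)/(cX+d)) (cX+d)^m, with denominators cleared; the sum already has
   degree <= m, so npolyp truncates nothing. *)
Definition slash p g : Vpoly R m :=
  npolyp m.+1 (\sum_(i < m.+1)
    p`_i *: (((g 0 0)%:C *: 'X + (g 0 1)%:C%:P) ^+ i
             * ((g 1 0)%:C *: 'X + (g 1 1)%:C%:P) ^+ (m - i))).

Definition act g p : Vpoly R m := slash p (invmx g).

Definition pairing p q : R[i] :=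
  \sum_(i < m.+1) (-1) ^+ i * p`_i * q`_(m - i) / 'C(m, i)%:R.

End Action.

Notation toR R g := (map_mx intr g : 'M[R]_2).

Definition congruence_subgroup (G : set 'M[int]_2) : Prop :=
  [/\ forall g, G g -> \det g = 1,
      G 1%:M,
      forall g h, G g -> G h -> G (g *m h),
      forall g, G g -> G (invmx g) &
      exists2 N : nat, (0 < N)%N &
        forall g : 'M[int]_2, \det g = 1 ->
          (forall i j, (N%:Z %| g i j - (1%:M : 'M[int]_2) i j)%Z) -> G g].

Definition finite_union_of_orbits (R : realType) (G : set 'M[int]_2)
    (S : set R[i]) : Prop :=
  exists T : set R[i], [/\ finite_set T, T `<=` @upper_half_plane R &
    S = [set mobius (toR R g) s | g in G & s in T]].

Definition invariant_subgroup (R : realType) (m : nat) (G : set 'M[int]_2)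
    (A : set (Vpoly R m)) : Prop :=
  subgroup A /\ forall g p, G g -> A p -> A (act (toR R g) p).

Definition pairing_subgroup (R : realType) (m : nat) (A B : set (Vpoly R m)) :
    set R[i] :=
  smallest (@subgroup R[i]) [set pairing a b | a in A & b in B].

Definition H0_trivial (R : realType) (m : nat) (G : set 'M[int]_2)
    (B : set (Vpoly R m)) (v : Vpoly R m) : Prop :=
  smallest (@subgroup (Vpoly R m)) [set act (toR R g) u - u | g in G & u in B] v.

Section Calculus.
Context {R : realType} {m : nat}.
Implicit Types (D U : set R[i]) (F : R[i] -> Vpoly R m).

Definition plane_point (p : R * R) : R[i] := p.1 +i* p.2.
Definition coords (z : R[i]) : R * R := (complex.Re z, complex.Im z).

Definition re_coef F (i : nat) (p : R * R) : R :=
  complex.Re (F (plane_point p))`_i.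
Definition im_coef F (i : nat) (p : R * R) : R :=
  complex.Im (F (plane_point p))`_i.

Fixpoint Cn (n : nat) (W : set (R * R)) (f : R * R -> R) : Prop :=
  if n is n'.+1 then
    (forall p, W p -> differentiable f p) /\ (forall v, Cn n' W ('D_v f))
  else forall p, W p -> {for p, continuous f}.

Definition smooth D F : Prop :=
  forall n i, (i <= m)%N ->
    Cn n (plane_point @^-1` D) (re_coef F i) /\
    Cn n (plane_point @^-1` D) (im_coef F i).

Definition partial (v : R * R) F (z : R[i]) : Vpoly R m :=
  npolyp m.+1 (\poly_(i < m.+1)
    ('D_v (re_coef F i) (coords z) +i* 'D_v (im_coef F i) (coords z))).

Notation partial_x := (partial (1, 0)).
Notation partial_y := (partial (0, 1)).

(* The 1-form om.1 dx + om.2 dy; only its values on the domain matter. *)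
Definition one_form := ((R[i] -> Vpoly R m) * (R[i] -> Vpoly R m))%type.
Implicit Type om : one_form.

Definition eval_form om (z xi : R[i]) : Vpoly R m :=
  (complex.Re xi)%:C *: om.1 z + (complex.Im xi)%:C *: om.2 z.

Definition smooth_form U om : Prop := smooth U om.1 /\ smooth U om.2.

Definition closed_form U om : Prop :=
  forall z, U z -> partial_x om.2 z = partial_y om.1 z.

Definition primitive_on D om F : Prop :=
  smooth D F /\
  forall z, D z -> partial_x F z = om.1 z /\ partial_y F z = om.2 z.

(* The differential of z |-> gz, for det g = 1, is multiplication by
   (cz + d)^-2. *)
Definition equivariant_form (G : set 'M[int]_2) U om : Prop :=
  forall g z xi, G g -> U z ->
    eval_form om (mobius (toR R g) z)
      (((toR R g 1 0)%:C * z + (toR R g 1 1)%:C) ^- 2 * xi) =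
    act (toR R g) (eval_form om z xi).

Definition velocity (c : R -> R[i]) (t : R) : R[i] :=
  derive1 (@complex.Re R \o c) t +i* derive1 (@complex.Im R \o c) t.

(* Asking for differentiability on all of R, not just on [0, 1], is harmless:
   a C^1 arc on [0, 1] extends to a C^1 map on R. *)
Definition C1_arc U (c : R -> R[i]) : Prop :=
  [/\ forall t, derivable (@complex.Re R \o c) t 1,
      forall t, derivable (@complex.Im R \o c) t 1,
      continuous (derive1 (@complex.Re R \o c)),
      continuous (derive1 (@complex.Im R \o c)) &
      forall t, 0 <= t <= 1 -> U (c t)].

(* Piecewise C^1 paths from a to b in U, as lists of consecutive arcs. *)
Fixpoint is_path U (a b : R[i]) (s : seq (R -> R[i])) : Prop :=
  if s is c :: s' then [/\ C1_arc U c, c 0 = a & is_path U (c 1) b s']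
  else a = b.

Definition arc_integral om (c : R -> R[i]) : Vpoly R m :=
  let f t := eval_form om (c t) (velocity c t) in
  npolyp m.+1 (\poly_(i < m.+1)
    ((\int[lebesgue_measure]_(t in `[0%R, 1%R]) complex.Re (f t)`_i)%R +i*
     (\int[lebesgue_measure]_(t in `[0%R, 1%R]) complex.Im (f t)`_i)%R)).

Definition path_integral om (s : seq (R -> R[i])) : Vpoly R m :=
  \sum_(c <- s) arc_integral om c.

Definition circle (s : R[i]) (r t : R) : R[i] :=
  s + r%:C * (cos (2 * pi * t) +i* sin (2 * pi * t)).

Definition small_loops_in (S : set R[i]) (A : set (Vpoly R m)) om : Prop :=
  forall s, S s -> \forall r \near 0^'+, A (arc_integral om (circle s r)).

(* phi represents modulo A the cocycle g |-> int_a^{ga} om; the integral modulo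
   A does not depend on the path, so one path is exhibited for each g. *)
Definition period_cocycle (G : set 'M[int]_2) U (A : set (Vpoly R m)) om
    (a : R[i]) (phi : 'M[int]_2 -> Vpoly R m) : Prop :=
  forall g, G g -> exists2 s, is_path U a (mobius (toR R g) a) s &
    congr_mod A (phi g) (path_integral om s).

Definition coboundary_mod (G : set 'M[int]_2) (A : set (Vpoly R m))
    (phi : 'M[int]_2 -> Vpoly R m) : Prop :=
  exists p, forall g, G g -> congr_mod A (phi g) (act (toR R g) p - p).

Definition H1_trivial (G : set 'M[int]_2) U (A : set (Vpoly R m)) om : Prop :=
  exists a phi, [/\ U a, period_cocycle G U A om a phi &
    coboundary_mod G A phi].

(* The V/A-valued function I on U is given by a lift to V (junk outside U). *)
Definition invariant_integral (G : set 'M[int]_2) U (A : set (Vpoly R m)) om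
    (I : R[i] -> Vpoly R m) : Prop :=
  (forall z, U z -> exists D h,
     [/\ open (plane_point @^-1` D), D z, D `<=` U, primitive_on D om h &
         forall w, D w -> congr_mod A (I w) (h w)]) /\
  (forall g z, G g -> U z ->
     congr_mod A (I (mobius (toR R g) z)) (act (toR R g) (I z))).

Definition representation (G : set 'M[int]_2) (B : set (Vpoly R m))
    (v : Vpoly R m) (n : nat) (g : 'I_n -> 'M[int]_2) (u : 'I_n -> Vpoly R m) :
    Prop :=
  [/\ forall i, G (g i), forall i, B (u i) &
      v = \sum_(i < n) (act (toR R (g i)) (u i) - u i)].

Definition period_paths U (z : R[i]) (n : nat) (g : 'I_n -> 'M[int]_2)
    (c : 'I_n -> seq (R -> R[i])) : Prop :=
  forall i, is_path U z (mobius (toR R (invmx (g i))) z) (c i).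

Definition period_sum om (n : nat) (u : 'I_n -> Vpoly R m)
    (c : 'I_n -> seq (R -> R[i])) : R[i] :=
  \sum_(i < n) pairing (path_integral om (c i)) (u i).

End Calculus.

Arguments one_form : clear implicits.

(* Main.v *)
(* The class of om in H^1 being trivial, om has an invariant integral I modulo A;
   given I, moving each group element across the invariant pairing gives
   (I(z), g u - u) = (g^-1 I(z) - I(z), u), and g^-1 I(z) - I(z) is congruent to
   I(g^-1 z) - I(z), the integral of om from z to g^-1 z.

   The existence of I rests on path independence modulo A in U.  Primitives
   modulo A on convex open sets minus S are unique up to a constant, because a
   convex open set minus a countable set is connected by broken lines.  They
   exist near every point of the half-plane: away from S by the Poincare lemma,
   and around a point of S because the monodromy is the integral along a small
   circle, hence in A.  By uniqueness they glue along chains of boxes to a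
   primitive modulo A on the whole half-plane minus S. *)
Require Import Defs.
From mathcomp Require Import all_boot all_order all_algebra.
From mathcomp Require Import all_classical all_reals all_analysis.
From mathcomp Require Import complex ring lra zify.
Set Implicit Arguments.
Unset Strict Implicit.
Unset Printing Implicit Defensive.

Import Order.TTheory GRing.Theory Num.Theory numFieldNormedType.Exports.

Local Open Scope classical_set_scope.
Local Open Scope complex_scope.
Local Open Scope ring_scope.

(** * Subgroups, the action and the pairing *)

(** [A] is an arbitrary subgroup, possibly dense, so a function with values in V/A has no
    derivative, and its constancy cannot be read off a vanishing differential. Hence derivatives are
    only taken of local lifts to V, restricted to curves, and constancy modulo [A] along a curve
    comes from an induction on the real parameter. Primitives are defined modulo a variable
    subgroup, so that the trivial one yields the exact primitives needed around a puncture. Two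
    invariant integrals differ by a constant that need not lie in [A]: it is only fixed by [G]
    modulo [A]. That suffices, because [v] is a sum of elements [g u - u]. This comparison is made
    directly and not through period sums, which would require constructing paths from [z] to its
    translates. The existence of an integral enters only when two period sums are compared. *)

Section Subgroups.
Variables (M : zmodType) (G : set M).
Hypothesis sG : subgroup G.

Lemma subgroup0 : G 0. Proof. exact: sG.1. Qed.

Lemma subgroupB x y : G x -> G y -> G (x - y). Proof. exact: sG.2. Qed.

Lemma subgroupN x : G x -> G (- x).
Proof. by move=> Gx; rewrite -sub0r; apply: subgroupB => //; exact: subgroup0. Qed.

Lemma subgroupD x y : G x -> G y -> G (x + y).
Proof. by move=> Gx Gy; rewrite -[y]opprK; apply: subgroupB => //; exact: subgroupN. Qed.

Lemma subgroup_sum n (f : 'I_n -> M) : (forall i, G (f i)) -> G (\sum_i f i).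
Proof.
by move=> Gf; apply: (big_ind G) => //; [exact: subgroup0 | exact: subgroupD].
Qed.

Lemma congr_mod_refl x : congr_mod G x x.
Proof. by rewrite /congr_mod subrr; exact: subgroup0. Qed.

Lemma congr_mod_sym x y : congr_mod G x y -> congr_mod G y x.
Proof. by rewrite /congr_mod -[y - x]opprB; exact: subgroupN. Qed.

Lemma congr_mod_trans y x z :
  congr_mod G x y -> congr_mod G y z -> congr_mod G x z.
Proof.
by rewrite /congr_mod => xy yz; rewrite -(subrKA y); exact: subgroupD.
Qed.

Lemma congr_modD x y x' y' :
  congr_mod G x y -> congr_mod G x' y' -> congr_mod G (x + x') (y + y').
Proof. by rewrite /congr_mod opprD addrACA; exact: subgroupD. Qed.

Lemma congr_modB x y x' y' :
  congr_mod G x y -> congr_mod G x' y' -> congr_mod G (x - x') (y - y').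
Proof.
rewrite /congr_mod => xy xy'.
have -> : x - x' - (y - y') = (x - y) - (x' - y').
  by rewrite !opprB [y' - y]addrC addrACA [- x' + y']addrC.
exact: subgroupB.
Qed.

End Subgroups.

Lemma subgroup_smallest (M : zmodType) (X : set M) :
  subgroup (smallest (@subgroup M) X).
Proof.
split=> [|x y Gx Gy H [sH XH]]; first by move=> H [[]].
by apply: subgroupB => //; [apply: Gx | apply: Gy].
Qed.

Section ActionTheory.
Context {R : realType} {m : nat}.
Implicit Types (p q : Vpoly R m) (g : 'M[R]_2).

(** The matrix of [slash] on the monomials, acting on row vectors; the guard reproduces the
    truncation by [npolyp]. This linearity later allows [act] to be differentiated along curves. *)
Definition slash_mx g (i j : nat) : R[i] :=
  if (j < m.+1)%N then
    ((((g 0 0)%:C *: 'X + (g 0 1)%:C%:P) ^+ i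
      * ((g 1 0)%:C *: 'X + (g 1 1)%:C%:P) ^+ (m - i)) : {poly R[i]})`_j
  else 0.

Lemma coef_slash p g j :
  (slash p g)`_j = \sum_(i < m.+1) p`_i * slash_mx g i j.
Proof.
rewrite coef_npolyp coef_sum /slash_mx; case: ltnP => // _; last first.
  by rewrite big1 // => i _; rewrite mulr0.
by apply: eq_bigr => i _; rewrite coefZ.
Qed.

Lemma coefD_V p q i : (p + q)`_i = p`_i + q`_i.
Proof. by rewrite coefD. Qed.

Lemma coefB_V p q i : (p - q)`_i = p`_i - q`_i.
Proof. by rewrite raddfB coefB. Qed.

Lemma coef0_V i : (0 : Vpoly R m)`_i = 0.
Proof. by rewrite coef0. Qed.

Lemma coefZ_V a p i : (a *: p)`_i = a * p`_i.
Proof. by rewrite coefZ. Qed.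

Lemma coef_sum_V n (f : 'I_n -> Vpoly R m) i :
  (\sum_k f k)`_i = \sum_k (f k)`_i.
Proof.
elim/big_ind2 : _ => [|x x' y y' <- <-|//]; first exact: coef0_V.
by rewrite coefD_V.
Qed.

Lemma coef_V_out p i : (m < i)%N -> p`_i = 0.
Proof. exact: big_coef_npoly. Qed.

Lemma slashB p q g : slash (p - q) g = slash p g - slash q g.
Proof.
apply/npolyP => j; rewrite coefB_V !coef_slash -sumrB.
by apply: eq_bigr => i _; rewrite coefB_V mulrBl.
Qed.

Lemma actB g p q : act g (p - q) = act g p - act g q.
Proof. exact: slashB. Qed.

Lemma pairingBl p p' q : pairing (p - p') q = pairing p q - pairing p' q.
Proof.
rewrite -sumrB; apply: eq_bigr => i _.
by rewrite coefB_V mulrBr !mulrBl.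
Qed.

Lemma pairingBr p q q' : pairing p (q - q') = pairing p q - pairing p q'.
Proof.
rewrite -sumrB; apply: eq_bigr => i _.
by rewrite coefB_V mulrBr !mulrBl.
Qed.

Lemma pairing_sumr n p (q : 'I_n -> Vpoly R m) :
  pairing p (\sum_i q i) = \sum_i pairing p (q i).
Proof.
rewrite /pairing exchange_big /=; apply: eq_bigr => i _.
by rewrite coef_sum_V mulr_sumr mulr_suml.
Qed.

Lemma coef_lin_exp (a b : R[i]) n j : (j <= n)%N ->
  ((a *: 'X + b%:P) ^+ n)`_j = 'C(n, j)%:R * (a ^+ j * b ^+ (n - j)).
Proof.
move=> jn; rewrite addrC exprDn coef_sum (bigD1 (Ordinal (jn : j < n.+1)%N)) //=.
rewrite coefMn exprZn -polyC_exp coefCM coefZ coefXn eqxx mulr1.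
rewrite [RHS]mulr_natl [b ^+ _ * _]mulrC big1 ?addr0 // => i ij.
rewrite coefMn exprZn -polyC_exp coefCM coefZ coefXn [j == i]eq_sym.
by rewrite (_ : (i == j :> nat) = false) ?mulr0 ?mul0rn //; exact/negbTE.
Qed.

(** The power [(X + x)^m]; the factor [1] makes it an instance of [coef_lin_exp]. *)
Definition test_poly (x : R[i]) : Vpoly R m :=
  npolyp m.+1 ((1 *: 'X + x%:P) ^+ m).

Lemma coef_test_poly x i : (i <= m)%N ->
  (test_poly x)`_i = 'C(m, i)%:R * x ^+ (m - i).
Proof.
by move=> im; rewrite coef_npolyp ltnS im coef_lin_exp // expr1n mul1r.
Qed.

Lemma bin_neq0 i : (i <= m)%N -> 'C(m, i)%:R != 0 :> R[i].
Proof. by move=> im; rewrite pnatr_eq0 -lt0n bin_gt0. Qed.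

(** The hypothesis says that [p] is [(u X + x)^m]. Its binomials cancel those of the pairing, which
    leaves the homogeneous form of [q] evaluated at [(x, - u)]. *)
Lemma pairing_binomial (u x : R[i]) p q :
  (forall i, (i <= m)%N -> p`_i = 'C(m, i)%:R * (u ^+ i * x ^+ (m - i))) ->
  pairing p q = \sum_(j < m.+1) q`_j * (x ^+ j * (- u) ^+ (m - j)).
Proof.
move=> pE; rewrite /pairing (reindex_inj rev_ord_inj) /=.
apply: eq_bigr => i _; rewrite subSS.
have im : (i <= m)%N by rewrite -ltnS.
rewrite pE ?leq_subr // subKn // [(- u) ^+ _]exprNn.
have := bin_neq0 (leq_subr i m).
by move=> C0; field.
Qed.

(** A linear substitution turns the power of a linear form into another such power, so
    [pairing_binomial] applies again. The proof is the binomial theorem read backwards. *)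
Lemma slash_test_poly x g i : (i <= m)%N ->
  (slash (test_poly x) g)`_i =
  'C(m, i)%:R * (((g 0 0)%:C + x * (g 1 0)%:C) ^+ i *
                 ((g 0 1)%:C + x * (g 1 1)%:C) ^+ (m - i)).
Proof.
move=> im; rewrite -coef_lin_exp // coef_npolyp ltnS im.
congr (polyseq _)`_i.
pose l1 : {poly R[i]} := (g 0 0)%:C *: 'X + (g 0 1)%:C%:P.
pose l2 : {poly R[i]} := (g 1 0)%:C *: 'X + (g 1 1)%:C%:P.
have -> : ((g 0 0)%:C + x * (g 1 0)%:C) *: 'X + ((g 0 1)%:C + x * (g 1 1)%:C)%:P
    = x *: l2 + l1 :> {poly R[i]}.
  rewrite /l1 /l2 -!mul_polyC !(polyCD, polyCM); ring.
rewrite [RHS]exprDn; apply: eq_bigr => j _; have jm : (j <= m)%N by rewrite -ltnS.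
rewrite coef_test_poly // exprZn -[in LHS]mul_polyC -[in RHS]mul_polyC -[RHS]mulr_natl polyCM polyC_natr.
by rewrite -!mulrA; congr (_ * (_ * _)); exact: mulrC.
Qed.

Lemma size_lin_exp (a b : R[i]) k : (size ((a *: 'X + b%:P) ^+ k) <= k.+1)%N.
Proof.
apply: (leq_trans (size_poly_exp_leq _ _)); rewrite ltnS.
rewrite -[X in (_ <= X)%N]mul1n leq_mul2r; apply/orP; right.
rewrite -subn1 leq_subLR addn1; apply: (leq_trans (size_polyD _ _)).
rewrite geq_max (leq_trans (size_scale_leq _ _)) ?size_polyX //=.
exact: (leq_trans (size_polyC_leq1 _)).
Qed.

Lemma horner_slash q g (x : R[i]) :
  (slash q g : {poly _}).[x] =
  \sum_(i < m.+1) q`_i * (((g 0 0)%:C * x + (g 0 1)%:C) ^+ i *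
                          ((g 1 0)%:C * x + (g 1 1)%:C) ^+ (m - i)).
Proof.
rewrite npolypK.
  by rewrite horner_sum; apply: eq_bigr => i _; rewrite !hornerE.
apply: (leq_trans (size_sum _ _ _)); apply/bigmax_leqP => i _.
apply: (leq_trans (size_scale_leq _ _)).
apply: (leq_trans (size_polyMleq _ _)).
have im : (i <= m)%N by rewrite -ltnS.
apply: (@leq_trans (i.+1 + (m - i).+1).-1); last by rewrite addnS /= addSn subnKC.
by rewrite -!subn1; apply: leq_sub2r; apply: leq_add; exact: size_lin_exp.
Qed.

Lemma horner_Vpoly q x : (q : {poly _}).[x] = \sum_(i < m.+1) q`_i * x ^+ i.
Proof. exact/horner_coef_wide/size_npoly. Qed.

Lemma adj2E g : [/\ (\adj g) 0 0 = g 1 1, (\adj g) 0 1 = - g 0 1,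
  (\adj g) 1 0 = - g 1 0 & (\adj g) 1 1 = g 0 0].
Proof.
by split; rewrite mxE /cofactor det_mx11 !mxE /= ?addn0 ?add0n ?expr0 ?expr1 ?sqrrN ?expr1n
  ?mul1r ?mulN1r; do ?[congr (- _)]; congr (g _ _); apply/val_inj.
Qed.

Lemma sign_shuffle (K : comNzRingType) (e e' c x y : K) : e ^+ 2 = 1 ->
  e * e' * (c * (e * x * y)) = c * (x * (e' * y)).
Proof.
move=> e2; transitivity (e ^+ 2 * (c * (x * (e' * y)))); first by ring.
by rewrite e2 mul1r.
Qed.

(* It suffices to test on the powers [(X + x)^m], against which the pairing is
   evaluation at [- x] up to sign: these powers span. *)
Lemma pairing_slash p q g : \det g = 1 ->
  pairing (slash p g) q = pairing p (slash q (\adj g)).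
Proof.
move=> detg; have [a00 a01 a10 a11] := adj2E g.
(* [L i] is the defect of the identity on the monomial [X^i]; by linearity in [p] it suffices that
   all these defects vanish. *)
pose L (i : nat) := \sum_(j < m.+1) (-1) ^+ j * slash_mx g i j * q`_(m - j) / 'C(m, j)%:R
   - (-1) ^+ i * (slash q (\adj g))`_(m - i) / 'C(m, i)%:R : R[i].
have LE r : pairing (slash r g) q - pairing r (slash q (\adj g)) =
    \sum_(i < m.+1) r`_i * L i.
  rewrite /L; under [RHS]eq_bigr do rewrite mulrBr.
  rewrite sumrB; congr (_ - _); last first.
    by apply: eq_bigr => i _; ring.
  rewrite /pairing; under eq_bigr do rewrite coef_slash mulr_sumr !mulr_suml.
  rewrite exchange_big /=; apply: eq_bigr => i _.
  by rewrite mulr_sumr; apply: eq_bigr => j _; ring.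
have test x : pairing (slash (test_poly x) g) q =
    pairing (test_poly x) (slash q (\adj g)).
  rewrite (pairing_binomial _ (fun i im => slash_test_poly x g im)).
  rewrite (@pairing_binomial 1 x); last first.
    by move=> i im; rewrite coef_test_poly // expr1n mul1r.
  transitivity ((-1) ^+ m * (slash q (\adj g) : {poly _}).[- x]).
    rewrite horner_slash mulr_sumr; apply: eq_bigr => i _.
    have im : (i <= m)%N by rewrite -ltnS.
    rewrite a00 a01 a10 a11 !rmorphN /= -[m in (-1) ^+ m](subnKC im) exprD.
    rewrite (_ : _ * - x + - _ = - ((g 0 1)%:C + x * (g 1 1)%:C)); last by ring.
    rewrite (_ : - _ * - x + _ = (g 0 0)%:C + x * (g 1 0)%:C); last by ring.
    rewrite ![(- (_ + _)) ^+ _]exprNn.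
    exact/esym/sign_shuffle/sqrr_sign.
  rewrite horner_Vpoly mulr_sumr; apply: eq_bigr => i _.
  have im : (i <= m)%N by rewrite -ltnS.
  rewrite -[m in (-1) ^+ m](subnKC im) exprD [(- x) ^+ _]exprNn -[_ ^+ i * x ^+ i]mulr1.
  by rewrite sign_shuffle ?mulr1 //; exact: sqrr_sign.
have L0 i : (i <= m)%N -> L i = 0.
  (* As a function of [x], the defect on [(X + x)^m] is the polynomial [P]. It vanishes at the
     [m + 1] points [0, ..., m], hence is zero, and the binomials can be divided out in
     characteristic 0. *)
  pose P : {poly R[i]} := \poly_(j < m.+1) ('C(m, m - j)%:R * L (m - j)%N).
  have PE x : P.[x] = 0.
    have /eqP := test x; rewrite -subr_eq0 LE => /eqP <-.
    rewrite horner_poly (reindex_inj rev_ord_inj) /=; apply: eq_bigr => j _.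
    have jm : (j <= m)%N by rewrite -ltnS.
    by rewrite subSS subKn // coef_test_poly //; ring.
  have P0 : P = 0.
    apply: (@roots_geq_poly_eq0 _ _ [seq k%:R | k <- iota 0 m.+1]).
    - by apply/allP => x _; apply/eqP.
    - rewrite map_inj_uniq ?iota_uniq // => a b /eqP.
      by rewrite eqr_nat => /eqP.
    - by rewrite size_map size_iota size_poly.
  move=> im; have := congr1 (fun Q : {poly _} => Q`_(m - i)) P0.
  rewrite coef_poly ltnS leq_subr coef0 subKn // => /eqP.
  by rewrite mulf_eq0 (negbTE (bin_neq0 im)) /= => /eqP.
apply/eqP; rewrite -subr_eq0 LE big1 // => i _.
by rewrite L0 ?mulr0 // -ltnS.
Qed.

Lemma invmx_adj (K : comUnitRingType) n (g : 'M[K]_n) : \det g = 1 -> invmx g = \adj g.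
Proof.
by move=> dg; rewrite /invmx unitmxE dg unitr1 invr1 scale1r.
Qed.

Lemma pairing_act p u g : \det g = 1 ->
  pairing p (act g u) = pairing (act (invmx g) p) u.
Proof.
by move=> dg; rewrite /act invmxK (invmx_adj dg); exact/esym/pairing_slash.
Qed.

End ActionTheory.

Lemma toR_invmx (R : realType) (g : 'M[int]_2) : \det g = 1 ->
  toR R (invmx g) = invmx (toR R g).
Proof.
by move=> dg; rewrite !invmx_adj ?det_map_mx ?dg // map_mx_adj.
Qed.

(** * Curves and Moebius maps *)

Section RealInduction.
Variable R : realType.

(** The local hypothesis lets [Q] spread in both directions near every point. At the supremum of the
    set where [Q] holds it would give [Q] beyond the supremum, unless [b] is already within
    reach. *)
Lemma real_induction (Q : R -> Prop) (a b : R) : a <= b -> Q a ->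
  (forall t, a <= t <= b -> exists2 e, 0 < e & forall s s',
     a <= s <= b -> a <= s' <= b -> `|s - t| < e -> `|s' - t| < e ->
     Q s -> Q s') ->
  Q b.
Proof.
move=> ab Qa loc; pose E := [set t : R | a <= t <= b /\ Q t].
have Ea : E a by split=> //; rewrite lexx.
have ubE : ubound E b by move=> t [/andP[]].
have supE : has_sup E by split; [exists a | exists b].
have aS : a <= sup E by apply: ub_le_sup => //; exists b.
have Sb : sup E <= b by apply: ge_sup => //; exists a.
have [|e e0 He] := loc (sup E); first by rewrite aS.
have [s Es es] := sup_adherent e0 supE.
have sS : s <= sup E by apply: ub_le_sup => //; exists b.
have step t : a <= t <= b -> `|t - sup E| < e -> Q t.
  move=> tab te; apply: (He s) => //; try exact: Es.1; try exact: Es.2.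
  by rewrite ltr_distlC; lra.
apply: (step b); first by rewrite ab lexx.
have [//|bS] := ltP `|b - sup E| e.
have {}bS : sup E + e <= b.
  by move: bS; rewrite ger0_norm ?subr_ge0 //; lra.
have : E (sup E + e / 2).
  split; first lra.
  apply: (step (sup E + e / 2)); first lra.
  rewrite (_ : _ - _ = e / 2); last by ring.
  by rewrite gtr0_norm; lra.
move=> /(ub_le_sup (ex_intro _ b ubE)); lra.
Qed.

End RealInduction.

Section CurveDerivative.
Context {R : realType}.
Implicit Types (f g c : R -> R[i]) (t : R) (d : R[i]).

(** The derivative of a plane curve at a real time, taken componentwise so that real calculus
    applies; no holomorphy is involved. *)
Definition cderiv f t d :=
  is_derive t 1 (@complex.Re R \o f) (complex.Re d) /\
  is_derive t 1 (@complex.Im R \o f) (complex.Im d).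

Lemma ReD (x y : R[i]) : complex.Re (x + y) = complex.Re x + complex.Re y.
Proof. by case: x y => [? ?] [? ?]. Qed.

Lemma ImD (x y : R[i]) : complex.Im (x + y) = complex.Im x + complex.Im y.
Proof. by case: x y => [? ?] [? ?]. Qed.

Lemma ReN (x : R[i]) : complex.Re (- x) = - complex.Re x.
Proof. by case: x => [? ?]. Qed.

Lemma ImN (x : R[i]) : complex.Im (- x) = - complex.Im x.
Proof. by case: x => [? ?]. Qed.

Lemma ReM (x y : R[i]) : complex.Re (x * y) =
  complex.Re x * complex.Re y - complex.Im x * complex.Im y.
Proof. by case: x y => [? ?] [? ?]. Qed.

Lemma ImM (x y : R[i]) : complex.Im (x * y) =
  complex.Re x * complex.Im y + complex.Im x * complex.Re y.
Proof. by case: x y => [? ?] [? ?]. Qed.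

Lemma ReV (x : R[i]) : complex.Re x^-1 =
  complex.Re x / (complex.Re x ^+ 2 + complex.Im x ^+ 2).
Proof. by case: x => [? ?]. Qed.

Lemma ImV (x : R[i]) : complex.Im x^-1 =
  - complex.Im x / (complex.Re x ^+ 2 + complex.Im x ^+ 2).
Proof. by case: x => [? ?]; rewrite /= mulNr. Qed.

Lemma complexP (x y : R[i]) :
  complex.Re x = complex.Re y -> complex.Im x = complex.Im y -> x = y.
Proof. by case: x y => [? ?] [? ?] /= -> ->. Qed.

Lemma is_derive_ext (f g : R -> R) t (d d' : R) :
  f =1 g -> d = d' -> is_derive t 1 f d -> is_derive t 1 g d'.
Proof. by move=> /funext -> ->. Qed.

Lemma cderiv_cst d t : cderiv (fun=> d) t 0.
Proof. by split; exact: is_derive_cst. Qed.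

Lemma cderiv_ext f g t d d' : f =1 g -> d = d' -> cderiv f t d -> cderiv g t d'.
Proof. by move=> /funext -> ->. Qed.

Lemma cderivD f g t d d' :
  cderiv f t d -> cderiv g t d' -> cderiv (fun s => f s + g s) t (d + d').
Proof.
move=> [f1 f2] [g1 g2]; split.
  by apply: is_derive_ext (is_deriveD f1 g1) => [s|] /=; rewrite ReD.
by apply: is_derive_ext (is_deriveD f2 g2) => [s|] /=; rewrite ImD.
Qed.

Lemma cderivN f t d : cderiv f t d -> cderiv (fun s => - f s) t (- d).
Proof.
move=> [f1 f2]; split.
  by apply: is_derive_ext (is_deriveN f1) => [s|] /=; rewrite ReN.
by apply: is_derive_ext (is_deriveN f2) => [s|] /=; rewrite ImN.
Qed.

Lemma cderivB f g t d d' :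
  cderiv f t d -> cderiv g t d' -> cderiv (fun s => f s - g s) t (d - d').
Proof. by move=> fd gd; apply: cderivD => //; exact: cderivN. Qed.

Lemma cderivM f g t d d' : cderiv f t d -> cderiv g t d' ->
  cderiv (fun s => f s * g s) t (d * g t + f t * d').
Proof.
move=> [f1 f2] [g1 g2]; split.
  apply: is_derive_ext (is_deriveB (is_deriveM f1 g1) (is_deriveM f2 g2)).
    by move=> s /=; rewrite ReM.
  by rewrite !(ReD, ReM) /= /GRing.scale /=; ring.
apply: is_derive_ext (is_deriveD (is_deriveM f1 g2) (is_deriveM f2 g1)).
  by move=> s /=; rewrite ImM.
by rewrite !(ImD, ImM) /= /GRing.scale /=; ring.
Qed.

Lemma cderivZ a f t d : cderiv f t d -> cderiv (fun s => a * f s) t (a * d).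
Proof.
move=> fd; apply: cderiv_ext (cderivM (cderiv_cst a t) fd) => //.
by rewrite mul0r add0r.
Qed.

Lemma normsq_gt0 (x : R[i]) : x != 0 -> 0 < complex.Re x ^+ 2 + complex.Im x ^+ 2.
Proof.
move=> x0; rewrite lt0r addr_ge0 ?sqr_ge0 // andbT.
apply: contra x0; rewrite paddr_eq0 ?sqr_ge0 // !sqrf_eq0.
by case: x => a b /= /andP[/eqP -> /eqP ->].
Qed.

Lemma is_derive_inv (f : R -> R) t (d : R) : f t != 0 -> is_derive t 1 f d ->
  is_derive t 1 (fun s => (f s)^-1) (- (f t) ^- 2 * d).
Proof.
move=> ft0 [df vd]; apply: DeriveDef; first exact: derivableV.
by rewrite deriveV // vd.
Qed.

Lemma cderivV f t d : f t != 0 -> cderiv f t d ->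
  cderiv (fun s => (f s)^-1) t (- d / f t ^+ 2).
Proof.
move=> ft0 [f1 f2]; have n0 := normsq_gt0 ft0.
have n1 : complex.Re (f t) * complex.Re (f t) + complex.Im (f t) * complex.Im (f t) != 0.
  by rewrite -!expr2 lt0r_neq0.
have N2 := @is_derive_inv (fun s => complex.Re (f s) * complex.Re (f s) +
  complex.Im (f s) * complex.Im (f s)) t _ n1
  (is_deriveD (is_deriveM f1 f1) (is_deriveM f2 f2)).
split.
  apply: is_derive_ext (is_deriveM f1 N2).
    by move=> s /=; rewrite ReV !expr2.
  rewrite !(ReM, ReN, ImN, ReV, ImV, expr2, ImM) /= /GRing.scale /=.
  have := n0; set x := complex.Re (f t); set y := complex.Im (f t) => {}n0.
  by field; apply/andP; split; nra.
apply: is_derive_ext (is_deriveM (is_deriveN f2) N2).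
  by move=> s /=; rewrite ImV !expr2.
rewrite !(ReM, ReN, ImN, ReV, ImV, expr2, ImM) /= /GRing.scale /=.
rewrite -[(- _) t]/(- complex.Im (f t)).
have := n0; set x := complex.Re (f t); set y := complex.Im (f t) => {}n0.
by field; apply/andP; split; nra.
Qed.

Lemma cderiv_sum n (f : 'I_n -> R -> R[i]) t (d : 'I_n -> R[i]) :
  (forall k, cderiv (f k) t (d k)) ->
  cderiv (fun s => \sum_k f k s) t (\sum_k d k).
Proof.
move=> fd; elim: n f d fd => [|n IHn] f d fd.
  by apply: cderiv_ext (cderiv_cst 0 t) => [s|]; rewrite big_ord0.
apply: cderiv_ext (cderivD (fd ord0) (IHn _ _ (fun k => fd (lift ord0 k)))).
  by move=> s; rewrite big_ord_recl.
by rewrite big_ord_recl.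
Qed.

Definition segment (a b : R[i]) t : R[i] := a + t%:C * (b - a).

Lemma cderiv_real t : cderiv (fun s => s%:C) t 1.
Proof.
split; first exact: is_derive_id.
exact: is_derive_cst.
Qed.

Lemma cderiv_segment a b t : cderiv (segment a b) t (b - a).
Proof.
apply: cderiv_ext (cderivD (cderiv_cst a t) (cderivM (cderiv_real t) (cderiv_cst (b - a) t))) => //.
by ring.
Qed.

Lemma cderiv0_eq f s t : s <= t ->
  (forall u, s <= u <= t -> cderiv f u 0) -> f s = f t.
Proof.
move=> st f0; apply: complexP.
  have [||c _ /eqP] := @MVT_segment R (@complex.Re R \o f) (fun=> 0) s t st.
  - by move=> x; rewrite in_itv /= => /andP[sx xt]; apply: (f0 x _).1; lra.
  - apply: derivable_within_continuous => x; rewrite in_itv /= => xst.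
    by have [[]] := f0 x xst.
  - by rewrite mul0r subr_eq0 => /eqP /= ->.
have [||c _ /eqP] := @MVT_segment R (@complex.Im R \o f) (fun=> 0) s t st.
- by move=> x; rewrite in_itv /= => /andP[sx xt]; apply: (f0 x _).2; lra.
- apply: derivable_within_continuous => x; rewrite in_itv /= => xst.
  by have [_ []] := f0 x xst.
- by rewrite mul0r subr_eq0 => /eqP /= ->.
Qed.

(** Balls of the sup norm on the coordinates: they match the product topology on [R * R] and are
    themselves boxes. *)
Definition square (w : R[i]) (e : R) : set R[i] :=
  [set z | `|complex.Re z - complex.Re w| < e /\
           `|complex.Im z - complex.Im w| < e].

Lemma is_derive_near (f : R -> R) t (d e : R) : is_derive t 1 f d -> 0 < e ->
  exists2 r, 0 < r & forall s, `|s - t| < r -> `|f s - f t| < e.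
Proof.
move=> [df _] e0; have /derivable1_diffP/differentiable_continuous cf := df.
have := cf; move=> /cvgrPdist_lt /(_ e e0) /nbhs_ballP [r r0 Hr].
exists r => // s st; rewrite distrC; apply: Hr.
by rewrite /ball /= distrC.
Qed.

Lemma cderiv_near f t d e : cderiv f t d -> 0 < e ->
  exists2 r, 0 < r & forall s, `|s - t| < r -> square (f t) e (f s).
Proof.
move=> [f1 f2] e0.
have [r1 r10 H1] := is_derive_near f1 e0.
have [r2 r20 H2] := is_derive_near f2 e0.
exists (Num.min r1 r2); first by rewrite lt_min r10.
move=> s; rewrite lt_min => /andP[s1 s2]; split; [exact: H1 | exact: H2].
Qed.

Lemma C1_arc_cderiv (U : set R[i]) c t : C1_arc U c -> cderiv c t (velocity c t).
Proof.
by move=> [c1 c2 _ _ _]; split; apply: DeriveDef => //=; rewrite derive1E.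
Qed.

End CurveDerivative.

Section Mobius.
Context {R : realType}.
Implicit Types (g h : 'M[R]_2) (z : R[i]).

Definition mobius_denom g z : R[i] := (g 1 0)%:C * z + (g 1 1)%:C.

Lemma det2 (K : comNzRingType) (g : 'M[K]_2) :
  \det g = g 0 0 * g 1 1 - g 0 1 * g 1 0.
Proof.
rewrite (expand_det_row _ 0) !big_ord_recl big_ord0 addr0 /cofactor !det_mx11 !mxE /=.
rewrite expr0 mul1r expr1 mulN1r mulrN.
by congr (_ * g _ _ - g _ _ * g _ _); apply/val_inj.
Qed.

Lemma mobius_denom_neq0 g z : \det g = 1 -> 0 < complex.Im z ->
  mobius_denom g z != 0.
Proof.
rewrite det2 => dg z0; apply/eqP => /[dup] /(congr1 (@complex.Im R)) + /(congr1 (@complex.Re R)).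
rewrite /mobius_denom ReD ImD ReM ImM /= mul0r addr0 => /eqP.
rewrite addr0 mulf_eq0 (gt_eqF z0) orbF => /eqP c0.
rewrite c0 !mul0r subrr add0r => d0; move: dg; rewrite c0 d0; lra.
Qed.

Lemma Im_mobius g z : \det g = 1 -> 0 < complex.Im z ->
  complex.Im (mobius g z) = complex.Im z /
    (complex.Re (mobius_denom g z) ^+ 2 + complex.Im (mobius_denom g z) ^+ 2).
Proof.
move=> dg z0; have n0 := normsq_gt0 (mobius_denom_neq0 dg z0).
rewrite /mobius -/(mobius_denom g z) ImM ReV ImV.
(* Inserting the determinant makes the two numerators equal as polynomials in the entries of [g] and
   the coordinates of [z]. *)
have -> : complex.Im z = complex.Im z * \det g by rewrite dg mulr1.
rewrite det2 -[X in _ * X + _ * _ = _]/(_ / _) !mulrA -mulrDl; congr (_ / _).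
by rewrite /mobius_denom !(ReD, ImD, ReM, ImM) /=; ring.
Qed.

Lemma mobius_upper g z : \det g = 1 -> upper_half_plane z ->
  upper_half_plane (mobius g z).
Proof.
move=> dg z0; rewrite /upper_half_plane /= Im_mobius // divr_gt0 //.
exact/normsq_gt0/mobius_denom_neq0.
Qed.

Lemma mulmx2E (K : comNzRingType) (g h : 'M[K]_2) i j :
  (g *m h) i j = g i 0 * h 0 j + g i 1 * h 1 j.
Proof.
rewrite mxE !big_ord_recl big_ord0 addr0.
by congr (g _ _ * h _ _ + g _ _ * h _ _); apply/val_inj.
Qed.

Lemma mobiusM g h z : \det g = 1 -> \det h = 1 -> upper_half_plane z ->
  mobius (g *m h) z = mobius g (mobius h z).
Proof.
move=> dg dh z0; have h0 := mobius_denom_neq0 dh z0.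
have g0 := mobius_denom_neq0 dg (mobius_upper dh z0).
(* The denominator is an automorphy factor, that is, a cocycle. *)
have e : mobius_denom (g *m h) z = mobius_denom g (mobius h z) * mobius_denom h z.
  rewrite /mobius_denom /mobius !mulmx2E !rmorphD !rmorphM /=.
  by field; exact: h0.
rewrite {1 2}/mobius -![_ * _ + (_ 1 1)%:C]/(mobius_denom _ _) e.
move: g0 h0; set A := mobius_denom g _; set D := mobius_denom h z => g0 h0.
rewrite [X in _ = (_ * X + _) / _]/mobius -/(mobius_denom h z) -/D.
have -> : ((g *m h) 0 0)%:C * z + ((g *m h) 0 1)%:C =
    (g 0 0)%:C * ((h 0 0)%:C * z + (h 0 1)%:C) + (g 0 1)%:C * D.
  by rewrite /D /mobius_denom !mulmx2E !rmorphD !rmorphM /=; ring.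
by field; rewrite g0 h0.
Qed.

Lemma mobius1 z : mobius 1%:M z = z.
Proof.
by rewrite /mobius !mxE /= mul1r mul0r !add0r addr0 divr1.
Qed.

(** The numerator of the derivative of a fractional linear map is the determinant; with value 1,
    only the factor occurring in [equivariant_form] remains. *)
Lemma cderiv_mobius g c t d : \det g = 1 -> upper_half_plane (c t) ->
  cderiv c t d ->
  cderiv (fun s => mobius g (c s)) t (mobius_denom g (c t) ^- 2 * d).
Proof.
move=> dg ct cd; have n0 := mobius_denom_neq0 dg ct.
have lin a b := cderivD (cderivZ a cd) (cderiv_cst b t).
have dinv := cderivV n0 (lin (g 1 0)%:C (g 1 1)%:C).
apply: cderiv_ext (cderivM (lin (g 0 0)%:C (g 0 1)%:C) dinv) => //.
have dg' : ((g 0 0)%:C * (g 1 1)%:C - (g 0 1)%:C * (g 1 0)%:C) = 1 :> R[i].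
  by rewrite -!rmorphM -rmorphB -det2 dg.
rewrite -[in RHS](mul1r d) -dg'; move: n0; rewrite /mobius_denom => n0.
by field.
Qed.

End Mobius.

(** * Primitives modulo a subgroup *)

Section Primitives.
Context {R : realType} {m : nat}.
Implicit Types (W D S : set R[i]) (A : set (Vpoly R m)).
Implicit Types (eta : R[i] -> R[i] -> Vpoly R m) (F h : R[i] -> Vpoly R m).

(* Differentiability is tested along curves only, which makes the chain rule for
   a change of variables immediate.  The form is given by its values
   [eta z xi] at the point [z] on the tangent vector [xi]. *)
Definition curve_primitive D eta h := forall c t d, D (c t) -> cderiv c t d ->
  forall i, cderiv (fun s => (h (c s))`_i) t (eta (c t) d)`_i.

(** The lift [h] is a primitive on the whole square, even where the square leaves [W]; only the
    congruence with [F] is restricted to [W]. [F] itself may jump by elements of [A]. *)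
Definition primitive_mod A W eta F := forall w, W w ->
  exists e h, [/\ 0 < e, curve_primitive (square w e) eta h &
    forall z, W z -> square w e z -> congr_mod A (F z) (h z)].

Definition square_open W := forall w, W w ->
  exists2 e, 0 < e & square w e `<=` W.

Definition convex W := forall a b t, W a -> W b -> 0 <= t <= 1 ->
  W (segment a b t).

Lemma square_sub (w : R[i]) e e' : e <= e' -> square w e `<=` square w e'.
Proof. by move=> ee z [z1 z2]; split; exact: lt_le_trans ee. Qed.

Lemma square_openI W W' : square_open W -> square_open W' ->
  square_open (W `&` W').
Proof.
move=> oW oW' w [Ww W'w]; have [e e0 eW] := oW _ Ww.
have [e' e'0 e'W] := oW' _ W'w; exists (Num.min e e'); first by rewrite lt_min e0.
move=> z zw; split; [apply: eW | apply: e'W]; apply: square_sub zw.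
  by rewrite ge_min lexx.
by rewrite ge_min lexx orbT.
Qed.

Lemma convexI W W' : convex W -> convex W' -> convex (W `&` W').
Proof.
by move=> cW cW' a b t [? ?] [? ?] t01; split; [exact: cW | exact: cW'].
Qed.

Lemma curve_primitive_sub D D' eta h : D' `<=` D ->
  curve_primitive D eta h -> curve_primitive D' eta h.
Proof. by move=> DD Dh c t d /DD; exact: Dh. Qed.

Lemma primitive_mod_sub A W W' eta F : W' `<=` W ->
  primitive_mod A W eta F -> primitive_mod A W' eta F.
Proof.
move=> WW WF w /WW /WF [e [h [e0 eh Fh]]]; exists e, h; split=> // z /WW.
exact: Fh.
Qed.

Lemma primitive_mod_weaken A A' W eta F : A `<=` A' ->
  primitive_mod A W eta F -> primitive_mod A' W eta F.
Proof.
move=> AA WF w /WF [e [h [e0 eh Fh]]]; exists e, h; split=> // z Wz zw.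
exact/AA/Fh.
Qed.

Lemma primitive_modD A W eta F (p : Vpoly R m) :
  primitive_mod A W eta F -> primitive_mod A W eta (fun w => F w + p).
Proof.
move=> WF w /WF [e [h [e0 eh Fh]]]; exists e, (fun w => h w + p); split=> //.
  move=> c t d ct cd i; apply: cderiv_ext (cderivD (eh c t d ct cd i) (cderiv_cst p`_i t)).
    by move=> s; rewrite coefD_V.
  by rewrite addr0.
by move=> z Wz zw; rewrite /congr_mod opprD addrACA subrr addr0; exact: Fh.
Qed.

(** Nearby values of [g] are congruent to values of a common lift with zero derivative, hence to
    each other. Real induction makes this global without any limit modulo [A]. *)
Lemma curve_const_mod A (g : R -> Vpoly R m) (a b : R) : subgroup A -> a <= b ->
  (forall t : R, a <= t <= b -> exists (e : R) (h : R -> Vpoly R m), [/\ 0 < e,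
     forall s, a <= s <= b -> `|s - t| < e ->
       forall i, cderiv (fun s => (h s)`_i) s 0 &
     forall s, a <= s <= b -> `|s - t| < e -> congr_mod A (g s) (h s)]) ->
  congr_mod A (g b) (g a).
Proof.
move=> sA ab loc; pose Q t := congr_mod A (g t) (g a).
apply: (@real_induction R Q a b) => //; first exact: congr_mod_refl.
move=> t /loc [e [h [e0 dh gh]]]; exists e => // s s' sab s'ab st s't Qs.
apply: congr_mod_trans Qs => //.
apply: (congr_mod_trans sA (gh s' s'ab s't)).
apply: (congr_mod_trans sA _ (congr_mod_sym sA (gh s sab st))).
suff -> : h s' = h s by exact: congr_mod_refl.
apply/npolyP => i.
wlog ss : s s' sab s'ab st s't / s <= s'.
  by move=> wl; have [/wl ->//|/ltW /wl ->//] := leP s s'.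
apply/esym/(@cderiv0_eq R (fun s => (h s)`_i)) => // u su; apply: dh; first lra.
by move: st s't; rewrite !ltr_norml; lra.
Qed.

(** The local lifts of [F] and [F'] have the same derivative along [c], so their difference is
    locally constant. *)
Lemma primitive_arc_unique A W eta F F' c : subgroup A ->
  primitive_mod A W eta F -> primitive_mod A W eta F' ->
  (forall t, 0 <= t <= 1 -> W (c t)) ->
  (forall t, 0 <= t <= 1 -> exists d, cderiv c t d) ->
  congr_mod A (F (c 1) - F' (c 1)) (F (c 0) - F' (c 0)).
Proof.
move=> sA WF WF' Wc dc.
apply: (@curve_const_mod A (fun t => F (c t) - F' (c t)) 0 1) => // t t01.
have [e [h [e0 eh Fh]]] := WF _ (Wc t t01).
have [e' [h' [e'0 e'h Fh']]] := WF' _ (Wc t t01).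
have [d cd] := dc t t01.
have [r r0 rc] := cderiv_near cd e0.
have [r' r'0 rc'] := cderiv_near cd e'0.
exists (Num.min r r'), (fun s => h (c s) - h' (c s)); split.
- by rewrite lt_min r0.
- move=> s s01; rewrite lt_min => /andP[sr sr'] i.
  have [d' cd'] := dc s s01.
  apply: cderiv_ext (cderivB (eh c s d' (rc _ sr) cd' i) (e'h c s d' (rc' _ sr') cd' i)).
    by move=> u; rewrite coefB_V.
  by rewrite subrr.
- move=> s s01; rewrite lt_min => /andP[sr sr'].
  by apply: congr_modB => //; [apply: Fh | apply: Fh'] => //;
    solve [exact: Wc | exact: rc | exact: rc'].
Qed.

Lemma segment0 (a b : R[i]) : segment a b 0 = a.
Proof. by rewrite /segment mul0r addr0. Qed.

Lemma segment1 (a b : R[i]) : segment a b 1 = b.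
Proof. by rewrite /segment mul1r addrC subrK. Qed.

(** A nonempty open interval has positive Lebesgue measure, a countable set has measure 0. *)
Lemma exists_notin_countable (B : set R) (e : R) : 0 < e -> countable B ->
  exists2 t, 0 < t < e & ~ B t.
Proof.
move=> e0 cB; apply: contrapT => nB.
have sub : `]0, e[%classic `<=` B.
  move=> t; rewrite /= in_itv /= => te; apply: contrapT => nBt.
  by apply: nB; exists t.
have : countable `]0, e[%classic by apply: sub_countable cB; exact: subset_card_le.
move=> /countable_lebesgue_measure0.
rewrite lebesgue_measure_itv /= lte_fin e0 oppr0 adde0 => -[] /eqP.
by rewrite gt_eqF.
Qed.

(* Each point of [S] lies on at most two of the broken lines [a, m, b] with [m]
   on the perpendicular bisector of [a] and [b]. *)
Lemma broken_line W S (a b : R[i]) : convex W -> square_open W -> countable S ->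
  (W `\` S) a -> (W `\` S) b ->
  exists m0, forall t, 0 <= t <= 1 ->
    (W `\` S) (segment a m0 t) /\ (W `\` S) (segment b m0 t).
Proof.
move=> cW oW cS [Wa Sa] [Wb Sb].
have [->|ab] := eqVneq a b.
  exists b => t t01; have -> : segment b b t = b by rewrite /segment subrr mulr0 addr0.
  by split; split.
have ba0 : b - a != 0 by rewrite subr_eq0 eq_sym.
pose mid := segment a b (1/2).
have Wmid : W mid by apply: cW => //; lra.
have [e e0 eW] := oW _ Wmid.
(* [K] bounds both coordinates of [b - a], and the added 1 keeps it positive; [t < e / K] then keeps
   the apex [pt t] inside the square around the midpoint. *)
pose K := `|complex.Re (b - a)| + `|complex.Im (b - a)| + 1.
have K0 : 0 < K by rewrite /K; have := normr_ge0 (complex.Re (b - a));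
  have := normr_ge0 (complex.Im (b - a)); lra.
pose pt (t : R) := mid + t%:C * ('i * (b - a)).
(* In the affine coordinate that sends [x] to 0 and [y] to 1, the apex is [1/2 + i t], so [t] is
   half the slope of any point on the ray towards it. Thus [f] reads off the only parameter whose
   broken line can pass through [s]; seen from [b] the sign changes. *)
pose f (x y s : R[i]) := complex.Im ((s - x) / (y - x)) / (2 * complex.Re ((s - x) / (y - x))).
have [|t /andP[t0 te] nt] := @exists_notin_countable
   (\bigcup_(s in S) [set f a b s; - f b a s]) (e / K) (divr_gt0 e0 K0).
  by apply: bigcup_countable => // s _; exact/finite_set_countable/finite_set2.
exists (pt t).
have Wpt : W (pt t).
  apply: eW; have tK : t * K < e by rewrite -ltr_pdivlMr.
  have tRe : t * `|complex.Re (b - a)| <= t * K.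
    rewrite ler_pM2l // /K; have := normr_ge0 (complex.Im (b - a)); lra.
  have tIm : t * `|complex.Im (b - a)| <= t * K.
    rewrite ler_pM2l // /K; have := normr_ge0 (complex.Re (b - a)); lra.
  move: tRe tIm; rewrite /pt; move: (b - a) => u tRe tIm.
  split; rewrite !(ReD, ImD, ReM, ImM) /= addrAC subrr add0r.
    rewrite [X in `|X|](_ : _ = t * - complex.Im u); last by ring.
    by rewrite normrM normrN gtr0_norm //; exact: le_lt_trans tK.
  rewrite [X in `|X|](_ : _ = t * complex.Re u); last by ring.
  by rewrite normrM gtr0_norm //; exact: le_lt_trans tK.
have dir (x y : R[i]) (l tt : R) : y - x != 0 -> l != 0 ->
    (forall s : R[i], s - x = l%:C * (y - x) * ((1/2) +i* tt) -> f x y s = tt).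
  move=> yx0 l0 s sE; rewrite /f sE mulrAC mulfK //.
  by rewrite ReM ImM /= !mul0r addr0 subr0; field.
move=> l l01; split; (split; first exact: cW); move=> Ss.
(* At [l = 0] the slope is undefined, but the point is the endpoint [a], which lies outside [S] by
   hypothesis. *)
- have [l0|l0] := eqVneq l 0; first by move: Ss; rewrite l0 segment0.
  apply: nt; exists (segment a (pt t) l) => //; left; apply/esym; apply: (dir a b l) => //.
  rewrite /segment addrC addKr /pt /mid /segment -mulrA; congr (_ * _).
  have -> : (1 / 2) +i* t = (1/2)%:C + t%:C * 'i :> R[i].
    by apply: complexP; rewrite !(ReD, ImD, ReM, ImM) /=; ring.
  by ring.
- have [l0|l0] := eqVneq l 0; first by move: Ss; rewrite l0 segment0.
  apply: nt; exists (segment b (pt t) l) => //; right.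
  rewrite (dir b a l (- t)) ?opprK //; first by rewrite -opprB oppr_eq0.
  rewrite /segment addrC addKr /pt /mid /segment -mulrA; congr (_ * _).
  have -> : (1 / 2) +i* (- t) = (1/2)%:C - t%:C * 'i :> R[i].
    by apply: complexP; rewrite !(ReD, ImD, ReM, ImM, ReN, ImN) /=; ring.
  have two : (1 / 2)%:C + (1 / 2)%:C = 1 :> R[i].
    by rewrite -rmorphD /=; congr (_%:C); lra.
  transitivity ((1 - (1/2)%:C) * (a - b) + t%:C * ('i * (b - a))); first by ring.
  by rewrite -{1}two; ring.
Qed.

Lemma primitive_unique A W S eta F F' a b : subgroup A ->
  convex W -> square_open W -> countable S ->
  primitive_mod A (W `\` S) eta F -> primitive_mod A (W `\` S) eta F' ->
  (W `\` S) a -> (W `\` S) b ->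
  congr_mod A (F a - F' a) (F b - F' b).
Proof.
move=> sA cW oW cS WF WF' Wa Wb; have [m0 Wm] := broken_line cW oW cS Wa Wb.
have dseg x t : exists d, cderiv (segment x m0) t d.
  by exists (m0 - x); exact: cderiv_segment.
have := primitive_arc_unique sA WF WF' (fun t t01 => (Wm t t01).1) (fun t _ => dseg a t).
have := primitive_arc_unique sA WF WF' (fun t t01 => (Wm t t01).2) (fun t _ => dseg b t).
rewrite !segment0 !segment1 => mb ma.
by apply: congr_mod_trans mb => //; exact: congr_mod_sym.
Qed.

Lemma primitive_unique_cst A W S eta F F' : subgroup A ->
  convex W -> square_open W -> countable S ->
  primitive_mod A (W `\` S) eta F -> primitive_mod A (W `\` S) eta F' ->
  exists p, forall w, (W `\` S) w -> congr_mod A (F w) (F' w + p).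
Proof.
move=> sA cW oW cS WF WF'.
have [[a Wa]|nW] := pselect (exists a, (W `\` S) a); last first.
  by exists 0 => w Ww; case: nW; exists w.
exists (F a - F' a) => w Ww; rewrite /congr_mod opprD addrA.
exact: primitive_unique sA cW oW cS WF WF' Ww Wa.
Qed.

Lemma primitive_glue_eq A W1 W2 S eta F1 F2 : subgroup A ->
  square_open W1 -> square_open W2 ->
  primitive_mod A (W1 `\` S) eta F1 -> primitive_mod A (W2 `\` S) eta F2 ->
  (forall w, ((W1 `&` W2) `\` S) w -> congr_mod A (F1 w) (F2 w)) ->
  primitive_mod A ((W1 `|` W2) `\` S) eta (fun w => if w \in W1 then F1 w else F2 w).
Proof.
move=> sA o1 o2 WF1 WF2 F12 w [] /= Ww nSw.
have [W1w|nW1w] := pselect (W1 w).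
  have [e [h [e0 eh Fh]]] := WF1 w (conj W1w nSw).
  have [e' e'0 e'W] := o1 w W1w.
  exists (Num.min e e'), h; split=> [||z [_ nSz] zw].
  - by rewrite lt_min e0.
  - by apply: curve_primitive_sub eh; apply: square_sub; rewrite ge_min lexx.
  - have W1z : W1 z by apply: e'W; apply: square_sub zw; rewrite ge_min lexx orbT.
    rewrite mem_set //; apply: Fh; first by split.
    by apply: square_sub zw; rewrite ge_min lexx.
have W2w : W2 w by case: Ww.
have [e [h [e0 eh Fh]]] := WF2 w (conj W2w nSw).
have [e' e'0 e'W] := o2 w W2w.
exists (Num.min e e'), h; split=> [||z [_ nSz] zw].
- by rewrite lt_min e0.
- by apply: curve_primitive_sub eh; apply: square_sub; rewrite ge_min lexx.
- have W2z : W2 z by apply: e'W; apply: square_sub zw; rewrite ge_min lexx orbT.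
  have F2z : congr_mod A (F2 z) (h z).
    apply: Fh; first by split.
    by apply: square_sub zw; rewrite ge_min lexx.
  (* A square around a point outside [W1] may still meet [W1], where the glued value is [F1];
     agreement on the overlap brings it back to [F2]. *)
  case: ifPn => // /set_mem W1z; apply: congr_mod_trans F2z => //.
  by apply: F12; split.
Qed.

Definition has_primitive A S eta W := exists F, primitive_mod A (W `\` S) eta F.

Lemma has_primitive_sub A S eta W W' : W' `<=` W ->
  has_primitive A S eta W -> has_primitive A S eta W'.
Proof.
move=> WW [F WF]; exists F; apply: primitive_mod_sub WF.
by move=> z [/WW Wz nSz]; split.
Qed.

(** Convexity of the overlap makes [F1 - F2] a single constant modulo [A] there, and shifting [F2]
    by it makes the two agree. *)
Lemma has_primitive_glue A S eta W1 W2 : subgroup A -> countable S ->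
  square_open W1 -> square_open W2 -> convex (W1 `&` W2) ->
  has_primitive A S eta W1 -> has_primitive A S eta W2 ->
  has_primitive A S eta (W1 `|` W2).
Proof.
move=> sA cS o1 o2 c12 [F1 WF1] [F2 WF2].
have [p F12] : exists p, forall w, ((W1 `&` W2) `\` S) w ->
    congr_mod A (F1 w) (F2 w + p).
  apply: (primitive_unique_cst sA c12 (square_openI o1 o2) cS (eta := eta)).
    by apply: primitive_mod_sub WF1 => z [[]].
  by apply: primitive_mod_sub WF2 => z [[]].
eexists; apply: (primitive_glue_eq sA o1 o2 WF1 _ F12).
exact: primitive_modD.
Qed.

End Primitives.

(** * Gluing local primitives over boxes and rectangles *)

Section Boxes.
Context {R : realType} {m : nat}.

Definition box (a b c d : R) : set R[i] :=
  [set w | a < complex.Re w < b /\ c < complex.Im w < d].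

Lemma box_open a b c d : square_open (box a b c d).
Proof.
move=> w [/andP[w1 w2] /andP[w3 w4]].
exists (Num.min (Num.min (complex.Re w - a) (b - complex.Re w))
         (Num.min (complex.Im w - c) (d - complex.Im w))).
  by rewrite !lt_min !subr_gt0 w1 w2 w3 w4.
move=> z []; rewrite !lt_min !ltr_norml => z1 z2; split; lra.
Qed.

Lemma segmentE (a b : R[i]) t :
  complex.Re (segment a b t) = (1 - t) * complex.Re a + t * complex.Re b /\
  complex.Im (segment a b t) = (1 - t) * complex.Im a + t * complex.Im b.
Proof.
by rewrite !(ReD, ImD, ReM, ImM, ReN, ImN) /=; split; ring.
Qed.

Lemma convex_comb (a b x y t : R) : 0 <= t <= 1 -> a < x < b -> a < y < b ->
  a < (1 - t) * x + t * y < b.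
Proof.
move=> t01 xab yab.
have -> : (1 - t) * x + t * y = x + t * (y - x) by ring.
have := mulr_ge0 (andP t01).1 (normr_ge0 (y - x)).
have : 0 <= (1 - t) * `|y - x| by apply: mulr_ge0 => //; lra.
by have [xy|xy] := lerP x y; rewrite !mulrBl !mulrBr; lra.
Qed.

Lemma box_convex a b c d : convex (box a b c d).
Proof.
move=> x y t [x1 x2] [y1 y2] t01; have [r i] := segmentE x y t.
by split; rewrite ?r ?i; exact: convex_comb.
Qed.

(* [P x y] stands for the existence of a primitive over the interval ]x, y[. *)
Lemma interval_chain (P : R -> R -> Prop) (a b : R) :
  (forall x y x' y', x <= x' -> y' <= y -> P x y -> P x' y') ->
  (forall x y x' y', x <= x' -> x' < y -> y <= y' -> P x y -> P x' y' -> P x y') ->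
  (forall x, a <= x <= b -> exists2 e, 0 < e & P (x - e) (x + e)) ->
  a <= b -> P a b.
Proof.
(* The overshoot past [t] guarantees that consecutive intervals overlap, as the gluing hypothesis
   requires. *)
move=> mono glue loc ab; pose Q t := exists2 s, t < s & P a s.
suff [s bs Ps] : Q b by apply: mono Ps; lra.
apply: (@real_induction R Q a b) => //.
  have [|e e0 Pe] := loc a; first lra.
  by exists (a + e); [lra | apply: mono Pe; lra].
move=> t tab; have [e e0 Pe] := loc t tab; exists e => // s s' sab s'ab.
rewrite !ltr_norml => st s't [s1 ss1 Ps1].
exists (t + e); first lra.
have [ate|ate] := leP a (t - e); last by apply: mono Pe; lra.
have [s1t|s1t] := leP (t + e) s1; first by apply: mono Ps1; lra.
by apply: glue Ps1 Pe => //; lra.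
Qed.

Variables (A : set (Vpoly R m)) (S : set R[i]) (eta : R[i] -> R[i] -> Vpoly R m).
Hypotheses (sA : subgroup A) (cS : countable S).
Variables X Y : set R.
Hypothesis oX : forall x, X x -> exists2 e, 0 < e & forall x', `|x' - x| < e -> X x'.
Hypothesis oY : forall x, Y x -> exists2 e, 0 < e & forall x', `|x' - x| < e -> Y x'.
Hypothesis iX : forall x y z, X x -> X y -> x <= z <= y -> X z.
Hypothesis iY : forall x y z, Y x -> Y y -> x <= z <= y -> Y z.

(** [X] and [Y] are open intervals, possibly unbounded: bounded ones give the exact primitives near
    a puncture, the full line and the positive half-line give the upper half-plane. *)
Let rect : set R[i] := [set w | X (complex.Re w) /\ Y (complex.Im w)].

Hypothesis local_primitive : forall w, rect w ->
  exists2 e, 0 < e & has_primitive A S eta (square w e).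

Let boxI a b c d a' b' c' d' :
  convex (box a b c d `&` box a' b' c' d').
Proof. by apply: convexI; exact: box_convex. Qed.

(** Two nested chains: at each height, squares are glued horizontally to a thin strip, and the
    strips are glued vertically. Since the corners lie in the open intervals, local primitives exist
    up to the boundary of the box. *)
Lemma box_primitive a b c d : X a -> X b -> Y c -> Y d -> a <= b -> c <= d ->
  has_primitive A S eta (box a b c d).
Proof.
move=> Xa Xb Yc Yd ab cd.
have glue a1 b1 c1 d1 a2 b2 c2 d2 := has_primitive_glue sA cS (eta := eta)
  (@box_open a1 b1 c1 d1) (@box_open a2 b2 c2 d2) (@boxI a1 b1 c1 d1 a2 b2 c2 d2).
apply: (@interval_chain (fun c d => has_primitive A S eta (box a b c d))) => //.
- move=> x y x' y' xx yy; apply: has_primitive_sub => z [z1 z2]; split=> //; lra.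
- move=> x y x' y' xx xy yy P1 P2; apply: has_primitive_sub (glue _ _ _ _ _ _ _ _ P1 P2).
  move=> z [z1 z2]; have [zy|yz] := ltP (complex.Im z) y.
    by left; split=> //; lra.
  by right; split=> //; lra.
move=> y yab.
(* The half-height is existential because each gluing shrinks it to the smaller of the two. *)
apply: (@interval_chain (fun a b => exists2 e : R, 0 < e &
   has_primitive A S eta (box a b (y - e) (y + e)))) => //.
- move=> x z x' z' xx zz [e e0 Pe]; exists e => //.
  by apply: has_primitive_sub Pe => u [u1 u2]; split=> //; lra.
- move=> x z x' z' xx xz zz [e e0 P1] [e' e'0 P2].
  have re : Num.min e e' <= e by rewrite ge_min lexx.
  have re' : Num.min e e' <= e' by rewrite ge_min lexx orbT.
  exists (Num.min e e'); first by rewrite lt_min e0.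
  apply: has_primitive_sub (glue _ _ _ _ _ _ _ _ P1 P2) => u [u1 u2].
  have [uz|zu] := ltP (complex.Re u) z.
    by left; split; lra.
  by right; split; lra.
move=> x xab; have [|e e0 Pe] := @local_primitive (x +i* y).
  by split=> /=; [exact: iX xab | exact: iY yab].
exists e => //; exists e => //; apply: has_primitive_sub Pe => u [u1 u2].
by split=> /=; rewrite ltr_norml; lra.
Qed.

Lemma open_hull (Z : set R) x y :
  (forall x, Z x -> exists2 e, 0 < e & forall x', `|x' - x| < e -> Z x') ->
  Z x -> Z y -> exists a b, [/\ Z a, Z b, a < x < b & a < y < b].
Proof.
move=> oZ Zx Zy.
wlog xy : x y Zx Zy / x <= y.
  move=> wl; have [/wl|/ltW /wl] := leP x y; first exact.
  by move=> /(_ Zy Zx) [a [b [? ? ? ?]]]; exists a, b.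
have [e e0 He] := oZ x Zx; have [e' e'0 He'] := oZ y Zy.
exists (x - e / 2), (y + e' / 2); split; try lra.
  apply: He; rewrite ltr_norml; lra.
apply: He'; rewrite ltr_norml; lra.
Qed.

(** Every point shares a box with the base point [a0], and the box primitives are normalised to
    vanish at [a0]. Two such boxes meet in a convex set containing [a0], so their primitives agree
    there modulo [A], whatever boxes were chosen. *)
Lemma rect_primitive : has_primitive A S eta rect.
Proof.
have [[a0 [[a0X a0Y] nSa]]|nW] := pselect (exists a, (rect `\` S) a); last first.
  by exists (fun=> 0) => w Ww; case: nW; exists w.
have loc (w : R[i]) : exists WF : set R[i] * (R[i] -> Vpoly R m),
   (rect `\` S) w -> [/\ convex WF.1, square_open WF.1, WF.1 a0 /\ WF.1 w,
     primitive_mod A (WF.1 `\` S) eta WF.2 & WF.2 a0 = 0].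
  have [[[wX wY] nSw]|] := pselect ((rect `\` S) w); last first.
    by move=> nw; exists (set0, fun=> 0).
  have [a [b [Xa Xb a0x wx]]] := open_hull oX a0X wX.
  have [c [d [Yc Yd a0y wy]]] := open_hull oY a0Y wY.
  have [|//|F WF] := box_primitive Xa Xb Yc Yd; try lra.
  exists (box a b c d, fun w => F w - F a0) => _; split=> //=.
  - exact: box_convex.
  - exact: box_open.
  - exact: primitive_modD.
  - by rewrite subrr.
have [WF HWF] := choice loc.
exists (fun w => (WF w).2 w) => w Ww.
have [cw ow [wa ww] Fw Fw0] := HWF w Ww.
have [e [h [e0 eh Fh]]] := Fw w (conj ww Ww.2).
have [e' e'0 e'W] := ow w ww.
exists (Num.min e e'), h; split=> [||z Wz zw].
- by rewrite lt_min e0.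
- by apply: curve_primitive_sub eh; apply: square_sub; rewrite ge_min lexx.
have [cz oz [za zz] Fz Fz0] := HWF z Wz.
have wz : (WF w).1 z by apply: e'W; apply: square_sub zw; rewrite ge_min lexx orbT.
have Fwz : congr_mod A ((WF w).2 z) (h z).
  apply: Fh; first by split=> //; exact: Wz.2.
  by apply: square_sub zw; rewrite ge_min lexx.
apply: congr_mod_trans Fwz => //.
have := @primitive_unique R m A ((WF w).1 `&` (WF z).1) S eta (WF z).2 (WF w).2 z a0 sA
  (convexI cw cz) (square_openI ow oz) cS.
rewrite Fz0 Fw0 subrr /congr_mod subr0; apply.
- by apply: primitive_mod_sub Fz => u [[]].
- by apply: primitive_mod_sub Fw => u [[]].
- by split=> //; exact: Wz.2.
- by [].
Qed.

End Boxes.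

(** * Integrals along arcs *)

Section Antiderivatives.
Context {R : realType}.
Notation mu := (@lebesgue_measure R).
Implicit Types (f F : R -> R).

Lemma is_deriveP f t (d : R) : derivable f t 1 -> derive1 f t = d ->
  is_derive t 1 f d.
Proof. by move=> df <-; apply: DeriveDef => //; rewrite derive1E. Qed.

Lemma continuous_within f (a b : R) :
  (forall t, a <= t <= b -> {for t, continuous f}) ->
  {within `[a, b], continuous f}.
Proof.
move=> cf; apply: continuous_in_subspaceT => t.
by rewrite inE /= in_itv /=; exact: cf.
Qed.

Lemma continuous_integrable f (a b : R) :
  (forall t, a <= t <= b -> {for t, continuous f}) ->
  mu.-integrable `[a, b] (EFin \o f).
Proof.
move=> cf; apply: continuous_compact_integrable; first exact: segment_compact.
exact: continuous_within.
Qed.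

Lemma continuous_clamp (a b t : R) :
  {for t, continuous (fun s : R => Num.max a (Num.min s b))}.
Proof.
apply: continuous_max; first exact: cvg_cst.
by apply: continuous_min; [exact: cvg_id | exact: cvg_cst].
Qed.

Lemma is_derive_integral f (a u x : R) : a < x < u ->
  (forall t, a <= t <= u -> {for t, continuous f}) ->
  is_derive x 1 (fun y => (\int[mu]_(t in `[a, y]) f t)%R) (f x).
Proof.
move=> /andP[ax xu] cf.
have [|//||d1 d2] := @continuous_FTC1_closed R f a x u xu.
- exact: continuous_integrable.
- by apply: cf; rewrite !ltW.
- exact: is_deriveP.
Qed.

Lemma antiderivative f (a b : R) : a <= b ->
  (forall t, a <= t <= b -> {for t, continuous f}) ->
  exists F, (forall t, a <= t <= b -> is_derive t 1 F (f t)) /\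
    (\int[mu]_(t in `[a, b]) f t)%R = F b - F a.
Proof.
(* Clamping the argument extends [f] continuously to the whole line, and the integral starts at
   [a - 1], so that the derivative is two-sided even at [a] and [b]. *)
move=> ab cf; pose f1 (t : R) := f (Num.max a (Num.min t b)).
have f1E t : a <= t <= b -> f1 t = f t.
  by move=> /andP[at_ tb]; rewrite /f1 min_l // max_r.
have cf1 t : {for t, continuous f1}.
  apply: (@continuous_comp _ _ _ (fun s : R => Num.max a (Num.min s b)) f).
    exact: continuous_clamp.
  by apply: cf; rewrite le_max lexx /= ge_max ab ge_min lexx orbT.
exists (fun y => (\int[mu]_(t in `[a - 1, y]) f1 t)%R); split.
  move=> t tab; rewrite -f1E //; apply: (@is_derive_integral _ _ (b + 1)) => //.
  by lra.
have -> : (\int[mu]_(t in `[a, b]) f t)%R = (\int[mu]_(t in `[a, b]) f1 t)%R.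
  by apply: eq_Rintegral => t; rewrite inE /= in_itv /= => /f1E.
rewrite Rintegral_itvB; first last.
- by rewrite bnd_simp.
- by rewrite bnd_simp; lra.
- exact: continuous_integrable.
rewrite -Rintegral_itv_obnd_cbnd //.
apply: (@integrableS _ _ _ mu `[a, b]%classic) => //; last exact: continuous_integrable.
by apply: subset_itvr; rewrite bnd_simp.
Qed.

End Antiderivatives.

Section ArcIntegral.
Context {R : realType} {m : nat}.
Implicit Types (U : set R[i]) (A : set (Vpoly R m)) (om : one_form R m).

Lemma eval_form_coef om z xi i : (eval_form om z xi)`_i =
  (complex.Re xi)%:C * (om.1 z)`_i + (complex.Im xi)%:C * (om.2 z)`_i.
Proof. by rewrite coefD_V !coefZ_V. Qed.

Lemma plane_pointK (z : R[i]) : plane_point (coords z) = z.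
Proof. by case: z. Qed.

Definition form_coefs_continuous U om := forall i z, (i <= m)%N -> U z ->
  [/\ {for coords z, continuous (re_coef om.1 i)},
      {for coords z, continuous (im_coef om.1 i)},
      {for coords z, continuous (re_coef om.2 i)} &
      {for coords z, continuous (im_coef om.2 i)}].

Lemma smooth_form_continuous U om : smooth_form U om -> form_coefs_continuous U om.
Proof.
move=> [s1 s2] i z im Uz; have Uz' : (@plane_point R @^-1` U) (coords z).
  by rewrite /preimage /= plane_pointK.
have [/(_ _ Uz') a /(_ _ Uz') b] := s1 0%N i im.
by have [/(_ _ Uz') c /(_ _ Uz') d] := s2 0%N i im.
Qed.

Lemma continuous_arc_integrand U om c : form_coefs_continuous U om -> C1_arc U c ->
  forall i t, (i <= m)%N -> 0 <= t <= 1 ->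
    {for t, continuous (fun s => complex.Re (eval_form om (c s) (velocity c s))`_i)} /\
    {for t, continuous (fun s => complex.Im (eval_form om (c s) (velocity c s))`_i)}.
Proof.
move=> cU [d1 d2 cv1 cv2 Uc] i t im t01.
have [a1 a2 a3 a4] := cU i _ im (Uc t t01).
have cc : {for t, continuous (coords \o c)}.
  have c1 : {for t, continuous (@complex.Re R \o c)}.
    by apply/differentiable_continuous/derivable1_diffP; exact: d1.
  have c2 : {for t, continuous (@complex.Im R \o c)}.
    by apply/differentiable_continuous/derivable1_diffP; exact: d2.
  exact: (cvg_pair c1 c2).
have comp (f : R * R -> R) : {for coords (c t), continuous f} ->
    {for t, continuous (fun s => f (coords (c s)))}.
  by move=> cf; apply: (@continuous_comp _ _ _ (coords \o c) f).
have v1 : {for t, continuous (fun s => complex.Re (velocity c s))} by exact: cv1.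
have v2 : {for t, continuous (fun s => complex.Im (velocity c s))} by exact: cv2.
split.
  rewrite (_ : (fun s => _) = (fun s => complex.Re (velocity c s) * re_coef om.1 i (coords (c s))
      + complex.Im (velocity c s) * re_coef om.2 i (coords (c s)))); last first.
    apply/funext => s; rewrite eval_form_coef ReD !ReM /= !mul0r !subr0.
    by rewrite /re_coef plane_pointK.
  by apply: continuousD; apply: continuousM => //; exact: comp.
rewrite (_ : (fun s => _) = (fun s => complex.Re (velocity c s) * im_coef om.1 i (coords (c s))
    + complex.Im (velocity c s) * im_coef om.2 i (coords (c s)))); last first.
  apply/funext => s; rewrite eval_form_coef ImD !ImM /= !mul0r !addr0.
  by rewrite /im_coef plane_pointK.
by apply: continuousD; apply: continuousM => //; exact: comp.
Qed.

Lemma coef_V_poly (f : nat -> R[i]) i :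
  (npolyp m.+1 (\poly_(j < m.+1) f j) : Vpoly R m)`_i = if (i <= m)%N then f i else 0.
Proof. by rewrite coef_npolyp coef_poly ltnS; case: (i <= m)%N. Qed.

Lemma arc_integral_antiderivative U om c :
  form_coefs_continuous U om -> C1_arc U c ->
  exists G : R -> Vpoly R m,
    (forall t, 0 <= t <= 1 ->
       forall i, cderiv (fun s => (G s)`_i) t (eval_form om (c t) (velocity c t))`_i) /\
    arc_integral om c = G 1 - G 0.
Proof.
move=> cU Uc; have cint := continuous_arc_integrand cU Uc.
have ex i : exists FG : (R -> R) * (R -> R), (i <= m)%N ->
   [/\ forall t, 0 <= t <= 1 -> cderiv (fun s => FG.1 s +i* FG.2 s) t
         (eval_form om (c t) (velocity c t))`_i,
    (\int[@lebesgue_measure R]_(t in `[0, 1]) complex.Re (eval_form om (c t) (velocity c t))`_i)%R = FG.1 1 - FG.1 0 &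
    (\int[@lebesgue_measure R]_(t in `[0, 1]) complex.Im (eval_form om (c t) (velocity c t))`_i)%R = FG.2 1 - FG.2 0].
  have [im|mi] := leqP i m; last by exists (fun=> 0, fun=> 0).
  have [F [dF iF]] := antiderivative ler01 (fun t t01 => (cint i t im t01).1).
  have [G [dG iG]] := antiderivative ler01 (fun t t01 => (cint i t im t01).2).
  exists (F, G) => _; split=> // t t01; split; [exact: dF | exact: dG].
have [FG HFG] := choice ex.
exists (fun t => npolyp m.+1 (\poly_(i < m.+1) ((FG i).1 t +i* (FG i).2 t))); split.
  move=> t t01 i; have [im|mi] := leqP i m.
    have [dFG _ _] := HFG i im.
    by apply: cderiv_ext (dFG t t01) => // s; rewrite coef_V_poly im.
  rewrite coef_V_out //; apply: cderiv_ext (cderiv_cst 0 t) => // s.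
  by rewrite coef_V_out.
apply/npolyP => i; rewrite coefB_V !coef_V_poly; case: ifP => [im|_]; last by rewrite subrr.
by have [_ -> ->] := HFG i im.
Qed.

(** Along [c], the local lifts of [F] have the same derivative as the antiderivative [G] of the
    integrand, so [F (c t) - G t] is constant modulo [A]. *)
Lemma arc_integral_primitive A W om F c : subgroup A ->
  form_coefs_continuous W om -> C1_arc W c ->
  primitive_mod A W (eval_form om) F ->
  congr_mod A (F (c 1) - F (c 0)) (arc_integral om c).
Proof.
move=> sA cW Wc WF; have [G [dG ->]] := arc_integral_antiderivative cW Wc.
have dc t := C1_arc_cderiv t Wc.
suff : congr_mod A (F (c 1) - G 1) (F (c 0) - G 0).
  rewrite /congr_mod; congr (A _).
  by rewrite !opprB addrACA [RHS]addrACA; congr (_ + _); rewrite addrC.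
apply: (@curve_const_mod _ _ A (fun t => F (c t) - G t) 0 1) => // t t01.
have Uc : forall t, 0 <= t <= 1 -> W (c t) by case: Wc.
have [e [h [e0 eh Fh]]] := WF _ (Uc t t01).
have [r r0 rc] := cderiv_near (dc t) e0.
exists r, (fun s => h (c s) - G s); split=> // s s01 sr.
  move=> i; apply: cderiv_ext (cderivB (eh c s _ (rc _ sr) (dc s) i) (dG s s01 i)).
    by move=> u; rewrite coefB_V.
  by rewrite subrr.
apply: congr_modB => //; last exact: congr_mod_refl.
by apply: Fh; [exact: Uc | exact: rc].
Qed.

Lemma path_integral_primitive A W om F a b s : subgroup A ->
  form_coefs_continuous W om -> is_path W a b s ->
  primitive_mod A W (eval_form om) F ->
  congr_mod A (F b - F a) (path_integral om s).
Proof.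
move=> sA cW + WF; elim: s a => [|c s IHs] a /=.
  by move=> ->; rewrite subrr /path_integral big_nil; exact: congr_mod_refl.
move=> [Wc <- ps]; rewrite /path_integral big_cons.
rewrite -(subrKA (F (c 1))) addrC; apply: congr_modD => //.
  exact: (arc_integral_primitive sA cW Wc WF).
exact: IHs.
Qed.

End ArcIntegral.

(** * The Poincare lemma *)

Section Poincare.
Context {R : realType}.
Notation mu := (@lebesgue_measure R).

Lemma is_derive1P (f : R -> R) (t d : R) :
  is_derive t 1 f d <-> h^-1 * (f (h + t) - f t) @[h --> 0^'] --> d.
Proof.
have E : (fun h : R => h^-1 *: ((f \o shift t) (h *: (1 : R)) - f t)) =
    (fun h => h^-1 * (f (h + t) - f t)).
  by apply/funext => h; rewrite /= [h *: _]mulr1.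
split=> [[]|].
  by rewrite /derivable /derive E => cf df; rewrite -df; exact: cf.
move=> cf; apply: DeriveDef; rewrite /derivable /derive E.
  by apply/cvg_ex; exists d.
exact/cvg_lim.
Qed.

(** A mean value theorem indifferent to the order of [a] and [b]; the bound on the distance from [a]
    is what allows intermediate points to be squeezed. *)
Lemma MVT_ball (f df : R -> R) (a b : R) :
  (forall x, `|x - a| <= `|b - a| -> is_derive x 1 f (df x)) ->
  exists2 c, `|c - a| <= `|b - a| & f b - f a = df c * (b - a).
Proof.
move=> dfx; have cf (u v : R) : (forall x, u <= x <= v -> `|x - a| <= `|b - a|) ->
    {within `[u, v], continuous f}.
  move=> uv; apply: derivable_within_continuous => x.
  by rewrite in_itv /= => /uv /dfx [].
have [ab|ba] := leP a b.
  have sub x : a <= x <= b -> `|x - a| <= `|b - a|.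
    by move=> ?; rewrite !ger0_norm; lra.
  have [||c cab ->] := @MVT_segment R f df a b ab.
  - by move=> x; rewrite in_itv /= => /andP[? ?]; apply/dfx/sub; lra.
  - exact: cf.
  by exists c => //; apply: sub; move: cab; rewrite in_itv.
have sub x : b <= x <= a -> `|x - a| <= `|b - a|.
  by move=> ?; rewrite !ler0_norm; lra.
have [||c cab E] := @MVT_segment R f df b a (ltW ba).
- by move=> x; rewrite in_itv /= => /andP[? ?]; apply/dfx/sub; lra.
- exact: cf.
exists c; first by apply: sub; move: cab; rewrite in_itv.
by rewrite -opprB E -mulrN opprB.
Qed.

(** The increment splits into a horizontal step at height [y s] and a vertical step at abscissa
    [x t]. The mean value theorem applies to each, the intermediate points tend to [(x t, y t)], and
    continuity of the partial derivatives concludes. *)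
Lemma curve_derive_of_partials (F P Q : R -> R -> R) (x y : R -> R) (t dx dy e : R) :
  0 < e ->
  (forall u v, `|u - x t| < e -> `|v - y t| < e ->
     is_derive u 1 (F^~ v) (P u v) /\ is_derive v 1 (F u) (Q u v)) ->
  {for (x t, y t), continuous (fun p => P p.1 p.2)} ->
  {for (x t, y t), continuous (fun p => Q p.1 p.2)} ->
  is_derive t 1 x dx -> is_derive t 1 y dy ->
  is_derive t 1 (fun s => F (x s) (y s)) (P (x t) (y t) * dx + Q (x t) (y t) * dy).
Proof.
move=> e0 dF cP cQ xd yd.
have [r1 r10 xr] := is_derive_near xd e0.
have [r2 r20 yr] := is_derive_near yd e0.
have ex s : exists xe : R * R, `|s - t| < Num.min r1 r2 ->
   [/\ `|xe.1 - x t| <= `|x s - x t|, `|xe.2 - y t| <= `|y s - y t| &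
    F (x s) (y s) - F (x t) (y t) =
     P xe.1 (y s) * (x s - x t) + Q (x t) xe.2 * (y s - y t)].
  have [st|st] := ltP `|s - t| (Num.min r1 r2); last by exists (0, 0).
  move: (st); rewrite lt_min => /andP[/xr xs /yr ys].
  have [|xi xi1 xi2] := @MVT_ball (F^~ (y s)) (P^~ (y s)) (x t) (x s).
    by move=> u us; apply: (dF u (y s) _ _).1 => //; exact: le_lt_trans xs.
  have [|eta eta1 eta2] := @MVT_ball (F (x t)) (Q (x t)) (y t) (y s).
    move=> u us; apply: (dF (x t) u _ _).2; first by rewrite subrr normr0.
    exact: le_lt_trans ys.
  by exists (xi, eta) => _; split=> //=; rewrite -xi2 -eta2 subrKA.
have [xe Hxe] := choice ex.
have nr : \forall h \near (0 : R)^', `|(h + t) - t| < Num.min r1 r2.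
  have r0 : 0 < Num.min r1 r2 by rewrite lt_min r10.
  near=> h; rewrite addrK; near: h; apply: dnbhs0_lt => //.
have sh : h + t @[h --> (0 : R)^'] --> t.
  apply: cvg_trans (_ : h + t @[h --> (0 : R)] --> t).
    by apply: cvg_app; exact: cvg_within.
  by rewrite -[X in _ --> X]add0r; apply: cvgD; [exact: cvg_id | exact: cvg_cst].
have cont (f : R -> R) d : is_derive t 1 f d -> f (h + t) @[h --> (0 : R)^'] --> f t.
  move=> [/derivable1_diffP/differentiable_continuous cf _].
  exact: (cvg_comp _ _ sh cf).
have squeeze (f g : R -> R) (l : R) : (\forall h \near (0 : R)^', `|f h - l| <= `|g h - l|) ->
    g h @[h --> (0 : R)^'] --> l -> f h @[h --> (0 : R)^'] --> l.
  move=> fg /cvgrPdist_lt cg; apply/cvgrPdist_lt => eps eps0.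
  near=> h; rewrite distrC; apply: (@le_lt_trans _ _ `|g h - l|); first by near: h.
  by rewrite distrC; near: h; exact: cg.
have cx := cont _ _ xd; have cy := cont _ _ yd.
have cxi : (xe (h + t)).1 @[h --> (0 : R)^'] --> x t.
  apply: squeeze cx; near=> h.
  by have [|//] := Hxe (h + t); near: h.
have ceta : (xe (h + t)).2 @[h --> (0 : R)^'] --> y t.
  apply: squeeze cy; near=> h.
  by have [|//] := Hxe (h + t); near: h.
have cPh : P (xe (h + t)).1 (y (h + t)) @[h --> (0 : R)^'] --> P (x t) (y t).
  exact: (cvg_comp (fun h => ((xe (h + t)).1, y (h + t))) _ (cvg_pair cxi cy) cP).
have cQh : Q (x t) (xe (h + t)).2 @[h --> (0 : R)^'] --> Q (x t) (y t).
  exact: (cvg_comp (fun h => (x t, (xe (h + t)).2)) _ (cvg_pair (cvg_cst _) ceta) cQ).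
apply/is_derive1P; move/is_derive1P : xd => xd; move/is_derive1P : yd => yd.
apply: cvg_trans (cvgD (cvgM cPh xd) (cvgM cQh yd)).
apply: near_eq_cvg; near=> h; rewrite /=.
have [|_ _ ->] := Hxe (h + t); first by near: h.
by rewrite !fctE /=; ring.
Unshelve. all: by end_near. Qed.

Lemma integral_of_derivative (f df : R -> R) (a b : R) : a <= b ->
  (forall t, a <= t <= b -> is_derive t 1 f (df t)) ->
  (forall t, a <= t <= b -> {for t, continuous df}) ->
  (\int[mu]_(t in `[a, b]) df t)%R = f b - f a.
Proof.
move=> ab fd cdf; have [G [dG ->]] := antiderivative ab cdf.
have d0 t : a <= t <= b -> is_derive t 1 (f - G) (df t - df t).
  by move=> tab; apply: is_deriveB; [exact: fd | exact: dG].
have [||c _] := @MVT_segment R (f - G) (fun t => df t - df t) a b ab.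
- by move=> x; rewrite in_itv /= => /andP[? ?]; apply: d0; lra.
- by apply: derivable_within_continuous => x; rewrite in_itv /= => /d0 [].
rewrite subrr mul0r !fctE => /eqP; rewrite subr_eq0 => /eqP E.
by apply/eqP; rewrite -subr_eq0 opprB addrA; move: E; lra.
Qed.

(** [F] integrates [P] along the bottom side of the square and then [Q] upwards. In [x],
    differentiation under the integral gives the integral of [Q1], which is also the [y]-derivative
    of [P], so the sum telescopes to [P x y]. The margin between [e] and [e'] provides a closed
    square on which the hypotheses hold. *)
Lemma partial_primitive (P Q Q1 : R -> R -> R) (px py e e' : R) : 0 < e < e' ->
  (forall x y, `|x - px| < e' -> `|y - py| < e' ->
    [/\ {for (x, y), continuous (fun p => P p.1 p.2)},
        {for (x, y), continuous (fun p => Q p.1 p.2)} &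
        {for (x, y), continuous (fun p => Q1 p.1 p.2)}] /\
    is_derive x 1 (Q^~ y) (Q1 x y) /\ is_derive y 1 (P x) (Q1 x y)) ->
  exists F : R -> R -> R, forall x y, `|x - px| < e -> `|y - py| < e ->
    is_derive x 1 (F^~ y) (P x y) /\ is_derive y 1 (F x) (Q x y).
Proof.
move=> ee' H.
have inx x : px - e <= x <= px + e -> `|x - px| < e'.
  by move=> ?; rewrite ltr_norml; lra.
have iny x : py - e <= x <= py + e -> `|x - py| < e'.
  by move=> ?; rewrite ltr_norml; lra.
have slice1 (f : R -> R -> R) x y : {for (x, y), continuous (fun p => f p.1 p.2)} ->
    {for x, continuous (f^~ y)}.
  move=> cf; apply: (@continuous_comp _ _ _ (fun s => (s, y)) (fun p => f p.1 p.2)) => //.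
  exact: (cvg_pair (@cvg_id _ _) (cvg_cst y)).
have slice2 (f : R -> R -> R) x y : {for (x, y), continuous (fun p => f p.1 p.2)} ->
    {for y, continuous (f x)}.
  move=> cf; apply: (@continuous_comp _ _ _ (fun s => (x, s)) (fun p => f p.1 p.2)) => //.
  exact: (cvg_pair (cvg_cst x) (@cvg_id _ _)).
have [al [dal _]] : exists al, (forall x, px - e <= x <= px + e ->
    is_derive x 1 al (P x (py - e))) /\
    (\int[mu]_(x in `[px - e, px + e]) P x (py - e))%R = al (px + e) - al (px - e).
  apply: antiderivative; first lra.
  move=> x xe; apply: slice1; have [|[cP _ _] _] := H x (py - e) (inx _ xe) => //.
  by apply: iny; lra.
exists (fun x y => al x + (\int[mu]_(s in `[py - e, y]) Q x s)%R) => x y.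
rewrite !ltr_norml => xe ye.
have xe' : px - e <= x <= px + e by lra.
split; last first.
  have dI : is_derive y 1 (fun v => (\int[mu]_(s in `[py - e, v]) Q x s)%R) (Q x y).
    apply: (@is_derive_integral _ _ _ (py + e)); first lra.
    by move=> s se; apply: slice2; have [[]] := H x s (inx _ xe') (iny _ se).
  apply: is_derive_ext (is_deriveD (is_derive_cst (al x) y 1) dI) => //.
  by rewrite add0r.
have intB : (\int[mu]_(s in `[py - e, y]) Q1 x s)%R = P x y - P x (py - e).
  apply: integral_of_derivative => [|s se|s se]; first lra.
    by have [|_ []] := H x s (inx _ xe') => //; apply: iny; lra.
  by apply: slice2; have [|[]] := H x s (inx _ xe') => //; apply: iny; lra.
have -> : P x y = P x (py - e) + (\int[mu]_(s in `[py - e, y]) Q1 x s)%R.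
  by rewrite intB addrC subrK.
apply: is_deriveD; first exact: dal.
(* Compactness of the closed square yields the constant that dominates the differentiated
   integrand. *)
have [M HM] : exists M, forall u v, px - e <= u <= px + e -> py - e <= v <= py + e ->
    `|Q1 u v| <= M.
  have cK := compact_setX (@segment_compact R (px - e) (px + e)) (@segment_compact R (py - e) (py + e)).
  have : compact ((fun p : R * R => Q1 p.1 p.2) @` (`[px - e, px + e] `*` `[py - e, py + e])).
    apply: continuous_compact cK; apply: continuous_in_subspaceT => -[u v].
    rewrite inE /= => -[]; rewrite /= !in_itv /= => ue ve.
    by have [[]] := H u v (inx _ ue) (iny _ ve).
  move=> /compact_bounded [M [_ /(_ (M + 1))]] HM; exists (M + 1) => u v ue ve.
  apply: HM; first by rewrite ltrDl.
  by exists (u, v) => //; split; rewrite /= in_itv.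
have M0 : 0 <= M.
  by apply: le_trans (HM x y _ _) => //; lra.
have par u v : px - e <= u <= px + e -> py - e <= v <= py + e ->
    is_derive u 1 (Q^~ v) (Q1 u v).
  by move=> ue ve; have [_ []] := H u v (inx _ ue) (iny _ ve).
have parE u v : px - e <= u <= px + e -> py - e <= v <= py + e ->
    partial1of2 Q u v = Q1 u v.
  by move=> ue ve; rewrite partial1of2E; have [] := par u v ue ve.
have mB : measurable (`[py - e, y]%classic : set (measurableTypeR R)) by exact: measurable_itv.
have Ix : `]px - e, px + e[%classic x by rewrite /= in_itv /=; lra.
have intQ u : `]px - e, px + e[%classic u ->
    mu.-integrable `[py - e, y] (EFin \o Q u).
  rewrite /= in_itv /= => ue; apply: continuous_integrable => s se.
  apply: slice2; have [||[]] := H u s => //; first by apply: inx; lra.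
  by apply: iny; lra.
have dQ u v : `]px - e, px + e[%classic u -> `[py - e, y]%classic v ->
    derivable (Q^~ v) u 1.
  by rewrite /= !in_itv /= => ue ve; have [||du _] := par u v; [lra | lra | exact: du].
have intM : mu.-integrable `[py - e, y] (EFin \o (fun=> M)).
  by apply: continuous_integrable => s _; exact: cvg_cst.
have QM u v : `]px - e, px + e[%classic u -> `[py - e, y]%classic v ->
    `|partial1of2 Q u v| <= M.
  rewrite /= !in_itv /= => ue ve.
  by rewrite parE; [apply: HM | |]; lra.
apply: is_deriveP.
  exact: (derivable_under_integral mB Ix intQ dQ (fun=> M0) intM QM).
rewrite (differentiation_under_integral mB Ix intQ dQ (fun=> M0) intM QM).
apply: eq_Rintegral => v; rewrite inE /= in_itv /= => ve.
by apply: parE; lra.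
Qed.

Lemma is_derive_slice1 (f : R * R -> R) (x y : R) : derivable f (x, y) (1, 0) ->
  is_derive x 1 (fun u => f (u, y)) ('D_(1, 0) f (x, y)).
Proof.
move=> df; have E : (fun h : R => h^-1 *: ((f \o shift (x, y)) (h *: ((1, 0) : R * R)) - f (x, y))) =
    (fun h => h^-1 * (f (h + x, y) - f (x, y))).
  apply/funext => h /=; rewrite /shift /=.
  by congr (_ *: (f _ - _)); congr (_, _); rewrite /= ?[h *: _]mulr1 // [h *: _]mulr0 add0r.
apply/is_derive1P; rewrite /derive E.
by move: df; rewrite /derivable E => /cvg_ex [l cl]; rewrite (cvg_lim _ cl).
Qed.

Lemma is_derive_slice2 (f : R * R -> R) (x y : R) : derivable f (x, y) (0, 1) ->
  is_derive y 1 (fun u => f (x, u)) ('D_(0, 1) f (x, y)).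
Proof.
move=> df; have E : (fun h : R => h^-1 *: ((f \o shift (x, y)) (h *: ((0, 1) : R * R)) - f (x, y))) =
    (fun h => h^-1 * (f (x, h + y) - f (x, y))).
  apply/funext => h /=; rewrite /shift /=.
  by congr (_ *: (f _ - _)); congr (_, _); rewrite /= ?[h *: _]mulr1 // [h *: _]mulr0 add0r.
apply/is_derive1P; rewrite /derive E.
by move: df; rewrite /derivable E => /cvg_ex [l cl]; rewrite (cvg_lim _ cl).
Qed.

Lemma real_poincare (P Q : R * R -> R) (W : set (R * R)) (px py e e' : R) :
  0 < e < e' ->
  (forall x y, `|x - px| < e' -> `|y - py| < e' -> W (x, y)) ->
  Cn 1 W P -> Cn 1 W Q ->
  (forall p, W p -> 'D_(1, 0) Q p = 'D_(0, 1) P p) ->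
  exists F : R -> R -> R, forall (x y : R -> R) (t dx dy : R),
    `|x t - px| < e -> `|y t - py| < e ->
    is_derive t 1 x dx -> is_derive t 1 y dy ->
    is_derive t 1 (fun s => F (x s) (y s)) (P (x t, y t) * dx + Q (x t, y t) * dy).
Proof.
move=> ee' inW [dP cP] [dQ cQ] PQ.
have pairE (f : R * R -> R) : (fun p => f (p.1, p.2)) = f by apply/funext => -[].
have [|x y xe ye|F HF] := @partial_primitive (fun x y => P (x, y)) (fun x y => Q (x, y))
  (fun x y => 'D_(1, 0) Q (x, y)) px py e e'; first exact: ee'.
  have Wxy := inW _ _ xe ye; split.
    rewrite !pairE; split.
    - exact: differentiable_continuous (dP _ Wxy).
    - exact: differentiable_continuous (dQ _ Wxy).
    - rewrite (_ : (fun p => _) = 'D_(1, 0) Q); last by apply/funext => -[].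
      exact: (cQ (1, 0) (x, y) Wxy).
  split; first by apply: is_derive_slice1; exact: diff_derivable (dQ _ Wxy).
  by rewrite PQ //; apply: is_derive_slice2; exact: diff_derivable (dP _ Wxy).
exists F => x y t dx dy xe ye xd yd.
have Wxy : W (x t, y t) by apply: inW; [apply: lt_trans xe _ | apply: lt_trans ye _]; lra.
pose r := Num.min (e - `|x t - px|) (e - `|y t - py|).
apply: (@curve_derive_of_partials F (fun x y => P (x, y)) (fun x y => Q (x, y)) x y t dx dy r) => //.
- by rewrite lt_min !subr_gt0 xe ye.
- move=> u v; rewrite !lt_min => /andP[u1 _] /andP[_ v1]; apply: HF.
    rewrite -(subrKA (x t)); apply: le_lt_trans (ler_normD _ _) _; lra.
  rewrite -(subrKA (y t)); apply: le_lt_trans (ler_normD _ _) _; lra.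
- by rewrite pairE; exact: differentiable_continuous (dP _ Wxy).
- by rewrite pairE; exact: differentiable_continuous (dQ _ Wxy).
Qed.

Lemma poincare (m : nat) (U : set R[i]) (om : one_form R m) w e e' : 0 < e < e' ->
  smooth_form U om -> closed_form U om -> square w e' `<=` U ->
  exists h, curve_primitive (square w e) (eval_form om) h.
Proof.
move=> ee' [s1 s2] cl wU.
pose W : set (R * R) := @plane_point R @^-1` U.
have inW x y : `|x - complex.Re w| < e' -> `|y - complex.Im w| < e' -> W (x, y).
  by move=> xe ye; apply: wU; split.
have clE i p : (i <= m)%N -> W p ->
    'D_(1, 0) (re_coef om.2 i) p = 'D_(0, 1) (re_coef om.1 i) p /\
    'D_(1, 0) (im_coef om.2 i) p = 'D_(0, 1) (im_coef om.1 i) p.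
  move=> im Wp; have /(congr1 (fun q : Vpoly R m => q`_i)) := cl _ Wp.
  by rewrite !coef_V_poly im; case: p {Wp} => x y [].
have ex i : exists FG : (R -> R -> R) * (R -> R -> R), (i <= m)%N ->
    (forall (x y : R -> R) (t dx dy : R),
    `|x t - complex.Re w| < e -> `|y t - complex.Im w| < e ->
    is_derive t 1 x dx -> is_derive t 1 y dy ->
    is_derive t 1 (fun s => FG.1 (x s) (y s))
      (re_coef om.1 i (x t, y t) * dx + re_coef om.2 i (x t, y t) * dy) /\
    is_derive t 1 (fun s => FG.2 (x s) (y s))
      (im_coef om.1 i (x t, y t) * dx + im_coef om.2 i (x t, y t) * dy)).
  have [im|mi] := leqP i m; last by exists (fun _ _ => 0, fun _ _ => 0).
  have [r1 i1] := s1 1%N i im; have [r2 i2] := s2 1%N i im.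
  have [F HF] := real_poincare ee' inW r1 r2 (fun p Wp => (clE i p im Wp).1).
  have [G HG] := real_poincare ee' inW i1 i2 (fun p Wp => (clE i p im Wp).2).
  by exists (F, G) => _ x y t dx dy *; split; [exact: HF | exact: HG].
have [FG HFG] := choice ex.
exists (fun z => npolyp m.+1 (\poly_(i < m.+1)
   ((FG i).1 (complex.Re z) (complex.Im z) +i* (FG i).2 (complex.Re z) (complex.Im z)))).
move=> c t d [cx cy] [c1 c2] i; have [im|mi] := leqP i m; last first.
  rewrite coef_V_out //; apply: cderiv_ext (cderiv_cst 0 t) => // s.
  by rewrite coef_V_out.
have [dr di] := HFG i im _ _ t _ _ cx cy c1 c2.
have ptE : plane_point (complex.Re (c t), complex.Im (c t)) = c t by case: (c t).
split.
  apply: is_derive_ext dr => [s|] /=; first by rewrite coef_V_poly im.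
  by rewrite eval_form_coef ReD !ReM /= !mul0r !subr0 /re_coef ptE; ring.
apply: is_derive_ext di => [s|] /=; first by rewrite coef_V_poly im.
by rewrite eval_form_coef ImD !ImM /= !mul0r !addr0 /im_coef ptE; ring.
Qed.

End Poincare.

(** * Discreteness of orbits *)

Section Orbits.
Context {R : realType}.
Implicit Types (G : set 'M[int]_2) (S T : set R[i]).

Definition normsq (z : R[i]) : R := complex.Re z ^+ 2 + complex.Im z ^+ 2.

Lemma normsqM z w : normsq (z * w) = normsq z * normsq w.
Proof. by rewrite /normsq ReM ImM; ring. Qed.

Lemma bounded_int_finite (B : R) : finite_set [set n : int | `|n%:~R| <= B].
Proof.
have [N BN] : exists N : nat, B <= N%:R.
  exists (Num.bound `|B|); apply: le_trans (ler_norm B) _.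
  exact/ltW/archi_boundP.
apply: (@sub_finite_set _ _ ((fun k : nat => k%:Z - N%:Z) @` `I_(2 * N).+1)); last first.
  exact/finite_image/finite_II.
move=> n /= nB; have : `|n%:~R| <= N%:R :> R by apply: le_trans BN.
rewrite -intr_norm -[N%:R]/(N%:Z%:~R) ler_int => nN.
exists (absz (n + N%:Z)); first by rewrite /=; lia.
by lia.
Qed.

Lemma bounded_mx_finite (B : R) :
  finite_set [set g : 'M[int]_2 | forall i j, `|(g i j)%:~R| <= B].
Proof.
have I := bounded_int_finite B.
pose mk (p : (int * int) * (int * int)) : 'M[int]_2 :=
  \matrix_(i, j) (if i == 0 then if j == 0 then p.1.1 else p.1.2
                  else if j == 0 then p.2.1 else p.2.2).
apply: (@sub_finite_set _ _ (mk @` (([set n : int | `|n%:~R| <= B] `*` [set n : int | `|n%:~R| <= B]) `*`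
   ([set n : int | `|n%:~R| <= B] `*` [set n : int | `|n%:~R| <= B])))); last first.
  by apply: finite_image; do ![apply: finite_setX => //].
move=> g gB; exists ((g 0 0, g 0 1), (g 1 0, g 1 1)); first by split; split; exact: gB.
have two (k : 'I_2) : k = 0 \/ k = 1.
  by case: k => [[|[|//]] kP]; [left | right]; apply/val_inj.
by apply/matrixP => i j; rewrite !mxE; case: (two i) => ->; case: (two j) => ->.
Qed.

(** The imaginary part of [a s + b] is [a * Im s], which bounds [a]; the real part then bounds [b].
    Only finiteness matters, so [L + 1] stands in for the square root of [L]. *)
Lemma linear_form_bound (a b L : R) (s : R[i]) : 0 < complex.Im s -> 0 <= L ->
  normsq (a%:C * s + b%:C) <= L ->
  let B := (L + 1) / complex.Im s in
  `|a| <= B /\ `|b| <= L + 1 + B * `|complex.Re s|.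
Proof.
move=> s0 L0; rewrite /normsq !(ReD, ImD, ReM, ImM) /= !mul0r subr0 !addr0 => H.
set x := complex.Re s in H *; set y := complex.Im s in s0 H *.
have sq_le (u : R) : u ^+ 2 <= L -> `|u| <= L + 1.
  by move=> uL; rewrite ler_norml; apply/andP; split; nra.
have ay : `|a * y| <= L + 1 by apply: sq_le; have := sqr_ge0 (a * x + b); lra.
have aB : `|a| <= (L + 1) / y by move: ay; rewrite normrM (gtr0_norm s0) ler_pdivlMr.
split=> //; rewrite -[b](addKr (a * x)) addrC; apply: le_trans (ler_normB _ _) _.
apply: lerD; first by apply: sq_le; have := sqr_ge0 (a * y); lra.
by rewrite normrM ler_wpM2r.
Qed.

(* A bound on [g s] from above and on its height from below bounds the
   denominator, hence both rows of [g]. *)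
Lemma orbit_near_finite G (s p : R[i]) (d : R) : (forall g, G g -> \det g = 1) ->
  upper_half_plane s -> 0 < d -> d < complex.Im p ->
  finite_set [set z | square p d z /\
    exists2 g, G g & z = mobius (toR R g) s].
Proof.
move=> detG s0 d0 dp.
(* [L0] bounds the squared modulus of the denominator of [g], because [Im s] divided by it is a
   height above [Im p - d]. [K] bounds the squared modulus of [z] on the square, so the numerator,
   [z] times the denominator, is bounded by [K * L0]; [L] dominates both. *)
pose L0 := complex.Im s / (complex.Im p - d).
pose K := (`|complex.Re p| + d) ^+ 2 + (complex.Im p + d) ^+ 2.
pose L := L0 + K * L0.
have L00 : 0 <= L0 by rewrite divr_ge0 //; [exact: ltW | lra].
have K0 : 0 <= K by rewrite addr_ge0 ?sqr_ge0.
have KL0 : 0 <= K * L0 by rewrite mulr_ge0.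
pose B := (L + 1) / complex.Im s.
pose B' := Num.max B (L + 1 + B * `|complex.Re s|).
apply: (@sub_finite_set _ _ ((fun g => mobius (toR R g) s) @`
   [set g : 'M[int]_2 | forall i j, `|(g i j)%:~R| <= B'])); last first.
  exact/finite_image/bounded_mx_finite.
move=> z [[z1 z2] [g Gg zE]]; exists g => //.
have dg : \det (toR R g) = 1 by rewrite det_map_mx detG.
have D0 := mobius_denom_neq0 dg s0; have N0 := normsq_gt0 D0.
have DL : normsq (mobius_denom (toR R g) s) <= L0.
  move: z2; rewrite zE Im_mobius // -/(normsq _) ltr_norml => z2.
  rewrite /L0 ler_pdivlMr; last lra.
  rewrite mulrC -ler_pdivlMr //; lra.
have NL : normsq ((g 0 0)%:~R%:C * s + (g 0 1)%:~R%:C) <= K * L0.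
  have -> : (g 0 0)%:~R%:C * s + (g 0 1)%:~R%:C = z * mobius_denom (toR R g) s.
    by rewrite zE /mobius -/(mobius_denom _ _) divfK // !mxE.
  rewrite normsqM; apply: ler_pM => //; first by rewrite addr_ge0 ?sqr_ge0.
    exact: ltW.
  move: z1 z2; rewrite !ltr_norml => z1 z2.
  have p1 := ler_norm (complex.Re p); have p2 := ler_norm (- complex.Re p).
  rewrite normrN in p2; rewrite /normsq /K; apply: lerD.
    by rewrite -[_ ^+ 2]real_normK ?num_real // ler_sqr ?nnegrE ?addr_ge0 ?(ltW d0) // ler_norml; lra.
  by rewrite ler_sqr ?nnegrE; lra.
have [r1 r2] : `|(g 1 0)%:~R| <= B' /\ `|(g 1 1)%:~R| <= B'.
  have [||h1 h2] := @linear_form_bound (g 1 0)%:~R (g 1 1)%:~R L s s0; first by rewrite addr_ge0.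
    by apply: (@le_trans _ _ L0); [move: DL; rewrite /mobius_denom !mxE | rewrite lerDl].
  by split; rewrite le_max ?h1 ?h2 ?orbT.
have [r3 r4] : `|(g 0 0)%:~R| <= B' /\ `|(g 0 1)%:~R| <= B'.
  have [||h1 h2] := @linear_form_bound (g 0 0)%:~R (g 0 1)%:~R L s s0; first by rewrite addr_ge0.
    by apply: le_trans NL _; rewrite lerDr.
  by split; rewrite le_max ?h1 ?h2 ?orbT.
have two (k : 'I_2) : k = 0 \/ k = 1.
  by case: k => [[|[|//]] kP]; [left | right]; apply/val_inj.
by move=> i j; case: (two i) => ->; case: (two j) => ->.
Qed.

Lemma orbits_countable G S : finite_union_of_orbits G S -> countable S.
Proof.
move=> [T [fT _ ->]].
have -> : [set mobius (toR R g) s | g in G & s in T] =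
    \bigcup_(s in T) ((fun g => mobius (toR R g) s) @` G).
  apply/seteqP; split=> [z [g Gg [s Ts <-]]|z [s Ts [g Gg <-]]].
    by exists s => //; exists g.
  by exists g => //; exists s.
apply: bigcup_countable; first exact: finite_set_countable.
move=> s _; apply: sub_countable (card_image_le _ _) _.
exact: countableP.
Qed.

Lemma finite_avoid (E : set R[i]) (p : R[i]) : finite_set E -> ~ E p ->
  exists2 e, 0 < e & forall z, E z -> ~ square p e z.
Proof.
move=> /finite_seqP [s ->]; elim: s => [|w s IHs] nEp.
  by exists 1 => // z; rewrite /= in_nil.
have [|e e0 He] := IHs.
  by apply: contra_not nEp => /= ps; rewrite in_cons ps orbT.
have wp : w != p by apply/eqP => wp; apply: nEp; rewrite /= wp mem_head.
pose r := Num.max `|complex.Re w - complex.Re p| `|complex.Im w - complex.Im p|.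
have r0 : 0 < r.
  rewrite lt_max !normr_gt0 !subr_eq0; apply: contraNT wp.
  rewrite negb_or !negbK => /andP[/eqP a /eqP b]; exact/eqP/complexP.
exists (Num.min e r); first by rewrite lt_min e0.
move=> z /=; rewrite in_cons => /orP[/eqP ->|zs].
  by move=> []; rewrite !lt_min /r !lt_max !ltxx /= orbF => /andP[_ a] /andP[_ b]; lra.
by move=> zp; apply: (He z zs); apply: square_sub zp; rewrite ge_min lexx.
Qed.

Lemma orbits_discrete G S p : (forall g, G g -> \det g = 1) ->
  finite_union_of_orbits G S -> upper_half_plane p ->
  exists2 e, 0 < e & forall z, square p e z ->
    upper_half_plane z /\ (S z -> z = p).
Proof.
move=> detG [T [fT TH SE]] p0; pose d := complex.Im p / 2.
have p0' : 0 < complex.Im p by [].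
have d0 : 0 < d by rewrite divr_gt0.
have fE : finite_set [set z | S z /\ square p d z /\ z <> p].
  apply: (@sub_finite_set _ _ (\bigcup_(s in T) [set z | square p d z /\
    exists2 g, G g & z = mobius (toR R g) s])).
    by move=> z [Sz [zp _]]; move: Sz; rewrite SE => -[g Gg [s Ts zE]]; exists s => //; split=> //; exists g.
  apply: bigcup_finite => // s Ts; apply: orbit_near_finite => //; first exact: TH.
  by rewrite /d; lra.
have [|e e0 He] := @finite_avoid _ p fE; first by case=> _ [].
exists (Num.min e d); first by rewrite lt_min e0.
move=> z zp; have zd : square p d z by apply: square_sub zp; rewrite ge_min lexx orbT.
have ze : square p e z by apply: square_sub zp; rewrite ge_min lexx.
split.
  by move: zd => [_]; rewrite ltr_norml /upper_half_plane /= /d; lra.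
move=> Sz; apply: contrapT => zNp; exact: (He z).
Qed.

End Orbits.

(** * Primitives around a puncture *)

Section Puncture.
Context {R : realType} {m : nat}.
Variables (S U : set R[i]) (om : one_form R m) (A : set (Vpoly R m)).
Hypotheses (sA : subgroup A) (cS : countable S).
Hypotheses (smooth_om : smooth_form U om) (closed_om : closed_form U om).

(** Exact primitives are primitives modulo the trivial subgroup, so uniqueness and gluing are shared
    with the case of [A]. *)
Let zero : set (Vpoly R m) := [set 0].

Lemma subgroup_zero : subgroup zero.
Proof. by split=> // x y -> ->; rewrite /zero /= subrr. Qed.

Lemma square_openU (W W' : set R[i]) : square_open W -> square_open W' ->
  square_open (W `|` W').
Proof.
move=> oW oW' w [/oW|/oW'] [e e0 eW]; exists e => // z /eW; [left | right] => //.
Qed.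

Lemma square_has_primitive w e (A' : set (Vpoly R m)) : subgroup A' -> 0 < e ->
  square w e `<=` U -> has_primitive A' S (eval_form om) (square w (e / 2)).
Proof.
move=> sA' e0 wU; have [|h hP] := poincare (e := e / 2) _ smooth_om closed_om wU.
  lra.
exists h => z [zw _]; pose r := Num.min (e / 2 - `|complex.Re z - complex.Re w|)
  (e / 2 - `|complex.Im z - complex.Im w|).
exists r, h; split.
- by case: zw => z1 z2; rewrite lt_min !subr_gt0 z1 z2.
- apply: curve_primitive_sub hP => u [u1 u2]; move: u1 u2.
  rewrite !lt_min => /andP[u1 _] /andP[_ u2]; split.
    by rewrite -(subrKA (complex.Re z)); apply: le_lt_trans (ler_normD _ _) _; lra.
  by rewrite -(subrKA (complex.Im z)); apply: le_lt_trans (ler_normD _ _) _; lra.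
- by move=> ? _ _; exact: congr_mod_refl.
Qed.

Lemma box_has_primitive a b c d : box a b c d `<=` U ->
  has_primitive zero S (eval_form om) (box a b c d).
Proof.
move=> bU.
have oI (u v : R) (x : R) : u < x < v ->
    exists2 e, 0 < e & forall x', `|x' - x| < e -> u < x' < v.
  move=> xuv; exists (Num.min (x - u) (v - x)).
    by rewrite lt_min !subr_gt0; lra.
  by move=> x'; rewrite lt_min !ltr_norml; lra.
apply: (@rect_primitive R m zero S (eval_form om) subgroup_zero cS
  (fun x => a < x < b) (fun y => c < y < d)).
- exact: oI.
- exact: oI.
- by move=> x y z ? ? ?; lra.
- by move=> x y z ? ? ?; lra.
move=> w wb; have [e e0 eW] := @box_open R a b c d w wb.
exists (e / 2); first lra.
by apply: square_has_primitive => //; [exact: subgroup_zero | exact: subset_trans eW bU].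
Qed.

Lemma circleE (p : R[i]) r t :
  complex.Re (circle p r t) = complex.Re p + r * cos (2 * pi * t) /\
  complex.Im (circle p r t) = complex.Im p + r * sin (2 * pi * t).
Proof. by rewrite !(ReD, ImD, ReM, ImM) /= !mul0r subr0 addr0. Qed.

Lemma circle_C1 (W : set R[i]) (p : R[i]) r :
  (forall t, 0 <= t <= 1 -> W (circle p r t)) -> C1_arc W (circle p r).
Proof.
move=> Wc.
have lin (t : R) : is_derive t 1 (fun s : R => 2 * pi * s) (2 * pi).
  by apply: is_derive_ext (is_deriveZ (2 * pi) (is_derive_id t 1)) => // ; rewrite /GRing.scale /= mulr1.
have dRe (t : R) : is_derive t 1 (@complex.Re R \o circle p r) (r * (2 * pi * - sin (2 * pi * t))).
  have := @is_derive1_comp R cos (fun s : R => 2 * pi * s) t _ _ (is_derive_cos _) (lin t).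
  move=> /(is_deriveZ r) /(is_deriveD (is_derive_cst (complex.Re p) t 1)) H.
  apply: is_derive_ext H => [s|]; first by rewrite /= (circleE p r s).1.
  by rewrite add0r /GRing.scale /= [_ * (2 * pi)]mulrC.
have dIm (t : R) : is_derive t 1 (@complex.Im R \o circle p r) (r * (2 * pi * cos (2 * pi * t))).
  have := @is_derive1_comp R sin (fun s : R => 2 * pi * s) t _ _ (is_derive_sin _) (lin t).
  move=> /(is_deriveZ r) /(is_deriveD (is_derive_cst (complex.Im p) t 1)) H.
  apply: is_derive_ext H => [s|]; first by rewrite /= (circleE p r s).2.
  by rewrite add0r /GRing.scale /= [_ * (2 * pi)]mulrC.
have clin : continuous (fun s : R => 2 * pi * s).
  by move=> t; have [/derivable1_diffP/differentiable_continuous] := lin t.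
have csin : continuous (fun s : R => sin (2 * pi * s)).
  by move=> t; apply: continuous_comp; [exact: clin | exact: continuous_sin].
have ccos : continuous (fun s : R => cos (2 * pi * s)).
  by move=> t; apply: continuous_comp; [exact: clin | exact: continuous_cos].
split=> //.
- rewrite (_ : derive1 _ = (fun t => r * (2 * pi * - sin (2 * pi * t)))); last first.
    by apply/funext => t; rewrite derive1E; have [_ ->] := dRe t.
  move=> t; apply: cvgM; first exact: cvg_cst.
  by apply: cvgM; [exact: cvg_cst | apply: cvgN; exact: csin].
- rewrite (_ : derive1 _ = (fun t => r * (2 * pi * cos (2 * pi * t)))); last first.
    by apply/funext => t; rewrite derive1E; have [_ ->] := dIm t.
  move=> t; apply: cvgM; first exact: cvg_cst.
  by apply: cvgM; [exact: cvg_cst | exact: ccos].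
Qed.

(** Locates the circle in the half-planes around its centre: its first and last eighth lie to the
    right, and the upper, left and lower ones cover the time in between, the left one including the
    crossing at time [1 / 2]. *)
Lemma circle_signs (t : R) :
  [/\ 0 <= t <= 1 / 8 -> 0 < cos (2 * pi * t),
      7 / 8 <= t <= 1 -> 0 < cos (2 * pi * t),
      0 < t < 1 / 2 -> 0 < sin (2 * pi * t),
      1 / 4 < t < 3 / 4 -> cos (2 * pi * t) < 0 &
      1 / 2 < t < 1 -> sin (2 * pi * t) < 0].
Proof.
have p0 := pi_gt0 R.
split=> t01.
- by apply: cos_gt0_pihalf; nra.
- rewrite -[_ * t](subrK (pi *+ 2)) cosD2pi; apply: cos_gt0_pihalf.
  by rewrite -mulr_natl; nra.
- by apply: sin_gt0_pi; nra.
- rewrite -[_ * t](subrK pi) cosDpi oppr_lt0; apply: cos_gt0_pihalf; nra.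
- rewrite -[_ * t](subrK pi) sinDpi oppr_lt0; apply: sin_gt0_pi; nra.
Qed.

Lemma lift_arc_primitive (W : set R[i]) (F : R[i] -> Vpoly R m) (c : R -> R[i])
    (G : R -> Vpoly R m) (a b : R) : a <= b ->
  primitive_mod zero (W `\` S) (eval_form om) F ->
  (forall t, a <= t <= b -> (W `\` S) (c t)) ->
  (forall t, a <= t <= b -> cderiv c t (velocity c t)) ->
  (forall t, a <= t <= b ->
     forall i, cderiv (fun s => (G s)`_i) t (eval_form om (c t) (velocity c t))`_i) ->
  F (c b) - F (c a) = G b - G a.
Proof.
move=> ab WF Wc dc dG.
suff : congr_mod zero (F (c b) - G b) (F (c a) - G a).
  move=> /eqP; rewrite subr_eq0 => /eqP E.
  rewrite -[F (c b)](subrK (G b)) E addrAC [F (c a) - _]addrC addrK.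
  exact: addrC.
apply: (@curve_const_mod _ _ zero (fun t => F (c t) - G t) a b subgroup_zero) => // t tab.
have [e [h [e0 eh Fh]]] := WF _ (Wc t tab).
have [r r0 rc] := cderiv_near (dc t tab) e0.
exists r, (fun s => h (c s) - G s); split=> // s sab sr.
  move=> i; apply: cderiv_ext (cderivB (eh c s _ (rc _ sr) (dc s sab) i) (dG s sab i)).
    by move=> u; rewrite coefB_V.
  by rewrite subrr.
apply: congr_modB; first exact: subgroup_zero.
  by apply: Fh; [exact: Wc | exact: rc].
by apply: congr_mod_refl; exact: subgroup_zero.
Qed.

(* Exact primitives exist on the complement [C] of the ray to the right of [p]
   and on the right half [Rt] of the square; normalised to agree above the ray,
   they differ below it by the integral along a small circle. *)
Lemma puncture_primitive (p : R[i]) (e : R) : 0 < e ->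
  (forall z, square p e z -> z <> p -> U z) -> (forall z, U z -> ~ S z) -> S p ->
  (\forall r \near 0^'+, A (arc_integral om (circle p r))) ->
  has_primitive A S (eval_form om) (square p e).
Proof.
move=> e0 eU US Sp loops.
set px := complex.Re p; set py := complex.Im p.
have sqU a b c d : px - e <= a -> b <= px + e -> py - e <= c -> d <= py + e ->
    ~ box a b c d p -> box a b c d `<=` U.
  move=> ? ? ? ? nb z [z1 z2]; apply: eU; first by split; rewrite ltr_norml -/px -/py; lra.
  by move=> zp; apply: nb; rewrite -zp.
pose Rt := box px (px + e) (py - e) (py + e).
pose Lf := box (px - e) px (py - e) (py + e).
pose Up := box (px - e) (px + e) py (py + e).
pose Dn := box (px - e) (px + e) (py - e) py.
have npR : ~ Rt p by case; rewrite -/px; lra.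
have npL : ~ Lf p by case; rewrite -/px; lra.
have npU : ~ Up p by case=> _; rewrite -/py; lra.
have npD : ~ Dn p by case=> _; rewrite -/py; lra.
have hR : has_primitive zero S (eval_form om) Rt by apply/box_has_primitive/sqU => //; lra.
have hL : has_primitive zero S (eval_form om) Lf by apply/box_has_primitive/sqU => //; lra.
have hU : has_primitive zero S (eval_form om) Up by apply/box_has_primitive/sqU => //; lra.
have hD : has_primitive zero S (eval_form om) Dn by apply/box_has_primitive/sqU => //; lra.
have boxI a b c d a' b' c' d' : convex (@box R a b c d `&` box a' b' c' d').
  by apply: convexI; exact: box_convex.
have oUL : square_open (Up `|` Lf) by apply: square_openU; exact: box_open.
pose C := (Up `|` Lf) `|` Dn.
have oC : square_open C by apply: square_openU => //; exact: box_open.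
(* The order of gluing keeps each overlap a single box: [Up] and [Dn] are disjoint, so [Dn] meets
   the union only in [Lf]. Adding [Rt] would close the loop, with an overlap in two components. *)
have [FC CF] : has_primitive zero S (eval_form om) C.
  apply: has_primitive_glue => //; [exact: subgroup_zero | exact: box_open | | ].
    rewrite (_ : _ `&` _ = Lf `&` Dn); first exact: boxI.
    apply/seteqP; split=> z; last by move=> [? ?]; split=> //; right.
    by move=> [[[_ z2]|?] [z3 z4]]; [lra | split].
  apply: has_primitive_glue => //; [exact: subgroup_zero | exact: box_open.. | exact: boxI].
have [FR0 RF0] := hR.
have [q0 RU] : exists q, forall w, ((Rt `&` Up) `\` S) w -> congr_mod zero (FC w) (FR0 w + q).
  apply: (primitive_unique_cst subgroup_zero (boxI _ _ _ _ _ _ _ _)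
    (square_openI (@box_open _ _ _ _ _) (@box_open _ _ _ _ _)) cS (eta := eval_form om)).
    by apply: primitive_mod_sub CF => z [[_ ?] ?]; split=> //; left; left.
  by apply: primitive_mod_sub RF0 => z [[]].
pose FR w := FR0 w + q0.
have RF : primitive_mod zero (Rt `\` S) (eval_form om) FR by exact: primitive_modD.
have [k RD] : exists q, forall w, ((Rt `&` Dn) `\` S) w -> congr_mod zero (FR w) (FC w + q).
  apply: (primitive_unique_cst subgroup_zero (boxI _ _ _ _ _ _ _ _)
    (square_openI (@box_open _ _ _ _ _) (@box_open _ _ _ _ _)) cS (eta := eval_form om)).
    by apply: primitive_mod_sub RF => z [[]].
  by apply: primitive_mod_sub CF => z [[_ ?] ?]; split=> //; right.
have Ak : A k.
  have [r [r0 re Ar]] : exists r : R, [/\ 0 < r, r < e & A (arc_integral om (circle p r))].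
    have : \forall r \near (0 : R)^'+, [/\ 0 < r, r < e & A (arc_integral om (circle p r))].
      near=> r; split; near: r; [exact: nbhs_right_gt | exact: nbhs_right_lt | exact: loops].
    by move=> /filter_ex [r Hr]; exists r.
  set c := circle p r in Ar.
  have cpos t : square p e (c t).
    have [cr ci] := circleE p r t; split; rewrite ?cr ?ci addrAC subrr add0r normrM gtr0_norm //.
      apply: le_lt_trans re; rewrite -[leRHS]mulr1 ler_pM2l // ler_norml.
      by rewrite cos_geN1 cos_le1.
    apply: le_lt_trans re; rewrite -[leRHS]mulr1 ler_pM2l // ler_norml.
    by rewrite sin_geN1 sin_le1.
  have cnp t : c t <> p.
    move=> cp; have [cr ci] := circleE p r t; move: cr ci; rewrite -/c cp.
    move=> /eqP; rewrite -subr_eq0 opprD addrA subrr sub0r oppr_eq0 mulf_eq0 gt_eqF //= => /eqP c0.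
    move=> /eqP; rewrite -subr_eq0 opprD addrA subrr sub0r oppr_eq0 mulf_eq0 gt_eqF //= => /eqP s0.
    by have := cos2Dsin2 (2 * pi * t); rewrite c0 s0; lra.
  have Uc t : U (c t) by apply: eU.
  have C1c : C1_arc U c by exact: circle_C1.
  have dc t := C1_arc_cderiv t C1c.
  have [G [dG arcE]] := arc_integral_antiderivative (smooth_form_continuous smooth_om) C1c.
  have nS t : ~ S (c t) by exact/US/Uc.
  have cin t : px - e < complex.Re (c t) < px + e /\ py - e < complex.Im (c t) < py + e.
    by have [] := cpos t; rewrite !ltr_norml -/px -/py; lra.
  have cR t : 0 < cos (2 * pi * t) -> (Rt `\` S) (c t).
    move=> cos0; have rc := mulr_gt0 r0 cos0; have [c1 c2] := cin t; split=> //.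
    by have [cr ci] := circleE p r t; split; move: c1 c2; rewrite cr -/px; lra.
  have cU t : 0 < sin (2 * pi * t) -> Up (c t).
    move=> sin0; have rc := mulr_gt0 r0 sin0; have [c1 c2] := cin t.
    by have [cr ci] := circleE p r t; split; move: c1 c2; rewrite ci -/py; lra.
  have cD t : sin (2 * pi * t) < 0 -> Dn (c t).
    move=> sin0; have rc : r * sin (2 * pi * t) < 0 by rewrite pmulr_rlt0.
    have [c1 c2] := cin t.
    by have [cr ci] := circleE p r t; split; move: c1 c2; rewrite ci -/py; lra.
  have cL t : cos (2 * pi * t) < 0 -> Lf (c t).
    move=> cos0; have rc : r * cos (2 * pi * t) < 0 by rewrite pmulr_rlt0.
    have [c1 c2] := cin t.
    by have [cr ci] := circleE p r t; split; move: c1 c2; rewrite cr -/px; lra.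
  (* The circle starts on the ray missing from [C], so its first and last eighth are integrated with
     [FR] and the rest with [FC]. The two agree at time [1 / 8], above the ray, and the jump [k] at
     time [7 / 8] is what remains. *)
  have E1 : FR (c (1 / 8)) - FR (c 0) = G (1 / 8) - G 0.
    apply: (lift_arc_primitive _ RF) => [|t tab|t _|t tab]; first lra.
    - by apply: cR; have [H _ _ _ _] := circle_signs t; apply: H.
    - exact: dc.
    - apply: dG; lra.
  have E2 : FC (c (7 / 8)) - FC (c (1 / 8)) = G (7 / 8) - G (1 / 8).
    apply: (lift_arc_primitive _ CF) => [|t tab|t _|t tab]; first lra.
    - split=> //; have [_ _ H1 H2 H3] := circle_signs t.
      have [t1|t1] := ltP t (1 / 2); first by left; left; apply/cU/H1; lra.
      have [t2|t2] := ltP t (3 / 4); first by left; right; apply/cL/H2; lra.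
      by right; apply/cD/H3; lra.
    - exact: dc.
    - apply: dG; lra.
  have E3 : FR (c 1) - FR (c (7 / 8)) = G 1 - G (7 / 8).
    apply: (lift_arc_primitive _ RF) => [|t tab|t _|t tab]; first lra.
    - by apply: cR; have [_ H _ _ _] := circle_signs t; apply: H.
    - exact: dc.
    - apply: dG; lra.
  have c01 : c 1 = c 0.
    by rewrite /c /circle !mulr1 !mulr0 cos0 sin0 mulr_natl cos2pi sin2pi.
  have E4 : FC (c (1 / 8)) = FR (c (1 / 8)).
    apply/eqP; rewrite -subr_eq0; apply/eqP; apply: RU; split; last exact: nS.
    have [H _ H' _ _] := circle_signs (1 / 8).
    by split; [apply: (cR _ (H _)).1; lra | apply/cU/H'; lra].
  have E5 : FR (c (7 / 8)) = FC (c (7 / 8)) + k.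
    apply/eqP; rewrite -subr_eq0; apply/eqP; apply: RD; split; last exact: nS.
    have [_ H _ _ H'] := circle_signs (7 / 8).
    by split; [apply: (cR _ (H _)).1; lra | apply/cD/H'; lra].
  have -> : k = - arc_integral om c.
    suff -> : arc_integral om c = - k by rewrite opprK.
    have -> : arc_integral om c = (G 1 - G (7 / 8)) + ((G (7 / 8) - G (1 / 8)) + (G (1 / 8) - G 0)).
      by rewrite !subrKA.
    by rewrite -E1 -E2 -E3 E4 E5 c01 subrKA [LHS]addrC subrKA opprD addrA subrr sub0r.
  exact: subgroupN.
have zA : zero `<=` A by move=> x ->; exact: subgroup0.
(* The two pieces miss only the centre [p] of the square, which belongs to [S]. *)
have cov : square p e `\` S `<=` (Rt `|` C) `\` S.
  move=> z [[z1 z2] nSz]; split=> //; move: z1 z2; rewrite !ltr_norml -/px -/py => z1 z2.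
  have [zx|zx|zx] := ltgtP (complex.Re z) px.
  - by right; left; right; split; lra.
  - by left; split; lra.
  have [zy|zy|zy] := ltgtP (complex.Im z) py.
  - by right; right; split; lra.
  - by right; left; left; split; lra.
  - by case: nSz; rewrite (complexP zx zy).
eexists; apply: primitive_mod_sub cov _.
apply: (@primitive_glue_eq _ _ A Rt C S _ FR FC) => //; first exact: box_open.
- exact: primitive_mod_weaken RF.
- exact: primitive_mod_weaken CF.
move=> w [[Rw Cw] nSw]; case: Cw => [[Uw|[wL _]]|Dw].
- by apply: congr_mod_sym => //; apply: zA; apply: RU.
- by case: Rw wL => /=; lra.
- have := RD w (conj (conj Rw Dw) nSw); rewrite /congr_mod opprD addrA => /eqP.
  by rewrite subr_eq0 => /eqP ->.
Unshelve. all: by end_near. Qed.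

End Puncture.

(** * Invariant integrals *)

Section Equivariance.
Context {R : realType} {m : nat}.
Implicit Types (U S D : set R[i]) (A B : set (Vpoly R m)) (om : one_form R m).

(** The bridge from smooth primitives to those tested along curves: the chain rule, with partial
    derivatives continuous by the first level of [Cn]. *)
Lemma primitive_on_curve D om h w e : primitive_on D om h -> square w e `<=` D ->
  curve_primitive (square w e) (eval_form om) h.
Proof.
move=> [sh dh] wD c t d ct cd i; have [im|mi] := leqP i m; last first.
  rewrite coef_V_out //; apply: cderiv_ext (cderiv_cst 0 t) => // s.
  by rewrite coef_V_out.
have [[dr cr] [di ci]] := sh 1%N i im.
have inW x y : `|x - complex.Re w| < e -> `|y - complex.Im w| < e ->
    (@plane_point R @^-1` D) (x, y) by move=> xe ye; apply: wD; split.
have [cx cy] := ct; have Wct := inW _ _ cx cy.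
have ptE : plane_point (complex.Re (c t), complex.Im (c t)) = c t by case: (c t).
pose r := Num.min (e - `|complex.Re (c t) - complex.Re w|) (e - `|complex.Im (c t) - complex.Im w|).
have r0 : 0 < r by rewrite lt_min !subr_gt0 cx cy.
have chain (f : R * R -> R) :
    (forall p, (@plane_point R @^-1` D) p -> differentiable f p) ->
    (forall v, Cn 0 (@plane_point R @^-1` D) ('D_v f)) ->
    is_derive t 1 (fun s => f (complex.Re (c s), complex.Im (c s)))
      ('D_(1, 0) f (complex.Re (c t), complex.Im (c t)) * complex.Re d +
       'D_(0, 1) f (complex.Re (c t), complex.Im (c t)) * complex.Im d).
  move=> df cf.
  apply: (@curve_derive_of_partials R (fun u v => f (u, v)) (fun u v => 'D_(1, 0) f (u, v))
    (fun u v => 'D_(0, 1) f (u, v)) (@complex.Re R \o c) (@complex.Im R \o c) t _ _ r r0) cd.1 cd.2.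
  - move=> u v; rewrite !lt_min => /andP[u1 _] /andP[_ v1].
    have Wuv : (@plane_point R @^-1` D) (u, v).
      apply: inW.
        rewrite -(subrKA (complex.Re (c t))); apply: le_lt_trans (ler_normD _ _) _.
        by move: u1; rewrite /=; lra.
      rewrite -(subrKA (complex.Im (c t))); apply: le_lt_trans (ler_normD _ _) _.
      by move: v1; rewrite /=; lra.
    by split; [apply: is_derive_slice1 | apply: is_derive_slice2]; exact: diff_derivable (df _ Wuv).
  - rewrite (_ : (fun p => _) = 'D_(1, 0) f); last by apply/funext => -[].
    exact: (cf (1, 0) _ Wct).
  - rewrite (_ : (fun p => _) = 'D_(0, 1) f); last by apply/funext => -[].
    exact: (cf (0, 1) _ Wct).
have [/(congr1 (fun q : Vpoly R m => q`_i)) e1 /(congr1 (fun q : Vpoly R m => q`_i)) e2] := dh _ (wD _ ct).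
move: e1 e2; rewrite !coef_V_poly im => e1 e2; split.
  apply: is_derive_ext (chain _ dr cr) => [s|].
    by rewrite /re_coef /=; case: (c s).
  rewrite eval_form_coef ReD !ReM /= !mul0r !subr0 -e1 -e2.
  by congr (_ + _); exact: mulrC.
apply: is_derive_ext (chain _ di ci) => [s|].
  by rewrite /im_coef /=; case: (c s).
rewrite eval_form_coef ImD !ImM /= !mul0r !addr0 -e1 -e2.
by congr (_ + _); exact: mulrC.
Qed.

Lemma open_square D w : open (@plane_point R @^-1` D) -> D w ->
  exists2 e, 0 < e & square w e `<=` D.
Proof.
rewrite openE => oD Dw; have : (@plane_point R @^-1` D) (coords w).
  by rewrite /preimage /= plane_pointK.
move=> /oD; rewrite /interior => /nbhs_ballP [e e0 eD]; exists e => // z [z1 z2].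
have : (@plane_point R @^-1` D) (coords z).
  by apply: eD; split; rewrite /ball /= distrC.
by rewrite /preimage /= plane_pointK.
Qed.

(** The common form of a given invariant integral and of the one obtained by gluing: local lifts are
    tested along curves. *)
Definition equivariant_primitive (G : set 'M[int]_2) U A om I :=
  primitive_mod A U (eval_form om) I /\
  forall g z, G g -> U z -> congr_mod A (I (mobius (toR R g) z)) (act (toR R g) (I z)).

Lemma invariant_integral_primitive G U A om I :
  invariant_integral G U A om I -> equivariant_primitive G U A om I.
Proof.
move=> [loc eqv]; split=> // w /loc [D [h [oD Dw DU Dh Ih]]].
have [e e0 eD] := open_square oD Dw; exists e, h; split=> //.
  exact: primitive_on_curve Dh eD.
by move=> z _ /eD; exact: Ih.
Qed.

Lemma cderiv_act (g : 'M[R]_2) (f : R -> Vpoly R m) (q : Vpoly R m) t :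
  (forall i, cderiv (fun s => (f s)`_i) t q`_i) ->
  forall i, cderiv (fun s => (act g (f s))`_i) t (act g q)`_i.
Proof.
move=> df i.
have H : cderiv (fun s => \sum_(j < m.+1) (f s)`_j * slash_mx (m := m) (invmx g) j i) t
    (\sum_(j < m.+1) q`_j * slash_mx (m := m) (invmx g) j i).
  apply: cderiv_sum => j.
  apply: cderiv_ext (cderivM (df j) (cderiv_cst (slash_mx (m := m) (invmx g) j i) t)) => //.
  by rewrite mulr0 addr0.
by apply: cderiv_ext H => [s|]; rewrite coef_slash.
Qed.

(** By equivariance of [om], the lifts of [I (g z)] and [g I(z)] have the same derivative along the
    arc. Invariance of [A] lets [act] pass to the quotient. *)
Lemma equivariance_along_arc (G : set 'M[int]_2) U A om I g c :
  (forall z, U z -> upper_half_plane z) -> (forall z, U z -> U (mobius (toR R g) z)) ->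
  invariant_subgroup G A -> equivariant_form G U om -> G g -> \det g = 1 ->
  primitive_mod A U (eval_form om) I ->
  (forall t, 0 <= t <= 1 -> U (c t)) -> (forall t, exists d, cderiv c t d) ->
  congr_mod A (I (mobius (toR R g) (c 1)) - act (toR R g) (I (c 1)))
              (I (mobius (toR R g) (c 0)) - act (toR R g) (I (c 0))).
Proof.
move=> UH gU [sA iA] eqv Gg dg UI Uc dc.
have dg' : \det (toR R g) = 1 by rewrite det_map_mx dg.
apply: (@curve_const_mod _ _ A
  (fun t => I (mobius (toR R g) (c t)) - act (toR R g) (I (c t))) 0 1) => // t t01.
have [e [h [e0 eh Ih]]] := UI _ (gU _ (Uc t t01)).
have [e' [h' [e'0 e'h Ih']]] := UI _ (Uc t t01).
have [d cd] := dc t.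
have [r r0 rc] := cderiv_near (cderiv_mobius dg' (UH _ (Uc t t01)) cd) e0.
have [r' r'0 rc'] := cderiv_near cd e'0.
exists (Num.min r r'), (fun s => h (mobius (toR R g) (c s)) - act (toR R g) (h' (c s))); split.
- by rewrite lt_min r0.
- move=> s s01; rewrite lt_min => /andP[sr sr'] i; have [d' cd'] := dc s.
  have H1 := eh _ _ _ (rc _ sr) (cderiv_mobius dg' (UH _ (Uc s s01)) cd') i.
  have H2 := cderiv_act (toR R g) (e'h _ _ _ (rc' _ sr') cd') i.
  apply: cderiv_ext (cderivB H1 H2) => [u|]; first by rewrite coefB_V.
  by rewrite eqv ?subrr //; exact: Uc.
- move=> s s01; rewrite lt_min => /andP[sr sr']; apply: congr_modB => //.
    by apply: Ih; [exact/gU/Uc | exact: rc].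
  by rewrite /congr_mod -actB; apply: iA => //; apply: Ih'; [exact: Uc | exact: rc'].
Qed.

End Equivariance.

(** * Pairing with coboundaries and comparison with period sums *)

Section Pairings.
Context {R : realType} {m : nat}.
Variables (A B : set (Vpoly R m)).

Lemma pairing_subgroupP a b : A a -> B b -> pairing_subgroup A B (pairing a b).
Proof. by move=> Aa Bb X [_ XH]; apply: XH; exists a => //; exists b. Qed.

Lemma subgroup_pairing : subgroup (pairing_subgroup A B).
Proof. exact: subgroup_smallest. Qed.

Lemma pairing_coboundary (g : 'M[int]_2) (p u : Vpoly R m) : \det g = 1 ->
  pairing p (act (toR R g) u - u) = pairing (act (toR R (invmx g)) p - p) u.
Proof.
by move=> dg; rewrite pairingBr pairing_act ?det_map_mx ?dg // -toR_invmx // pairingBl.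
Qed.

Lemma period_sum_congr (G : set 'M[int]_2) U om I z v n (g : 'I_n -> 'M[int]_2) u c :
  (forall g, G g -> \det g = 1) -> (forall g, G g -> G (invmx g)) ->
  subgroup A -> smooth_form U om -> U z ->
  equivariant_primitive G U A om I -> representation G B v g u ->
  period_paths U z g c ->
  congr_mod (pairing_subgroup A B) (pairing (I z) v) (period_sum om u c).
Proof.
move=> detG invG sA sm Uz [UI eqv] [Gg Bu ->] paths.
rewrite pairing_sumr /congr_mod /period_sum -sumrB; apply: (subgroup_sum subgroup_pairing) => i.
rewrite pairing_coboundary ?detG // -pairingBl; apply: pairing_subgroupP => //.
apply: (congr_mod_trans sA _ (path_integral_primitive sA (smooth_form_continuous sm) (paths i) UI)).
apply: congr_modB => //; last exact: congr_mod_refl.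
by apply: congr_mod_sym => //; apply: eqv => //; exact/invG.
Qed.

End Pairings.

Theorem theorem1p3p4 (R : realType) (k : nat) (k_gt0 : (0 < k)%N)
    (G : set 'M[int]_2) (congG : congruence_subgroup G)
    (S : set R[i]) (orbS : finite_union_of_orbits G S)
    (U : set R[i]) (defU : U = @upper_half_plane R `\` S)
    (A B : set (Vpoly R (2 * k - 2)%N))
    (invA : invariant_subgroup G A) (invB : invariant_subgroup G B)
    (om : one_form R (2 * k - 2)%N)
    (smooth_om : smooth_form U om) (closed_om : closed_form U om)
    (equiv_om : equivariant_form G U om)
    (loops_om : small_loops_in S A om)
    (z : R[i]) (Uz : U z) (v : Vpoly R (2 * k - 2)%N) (Bv : B v)
    (H1_om : H1_trivial G U A om) (H0_v : H0_trivial G B v) :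
  [/\ forall I n (g : 'I_n -> 'M[int]_2) u c,
        invariant_integral G U A om I -> representation G B v g u ->
        period_paths U z g c ->
        congr_mod (pairing_subgroup A B) (pairing (I z) v) (period_sum om u c),
      forall I I',
        invariant_integral G U A om I -> invariant_integral G U A om I' ->
        congr_mod (pairing_subgroup A B) (pairing (I z) v) (pairing (I' z) v) &
      forall n (g : 'I_n -> 'M[int]_2) u c n' (g' : 'I_n' -> 'M[int]_2) u' c',
        representation G B v g u -> period_paths U z g c ->
        representation G B v g' u' -> period_paths U z g' c' ->
        congr_mod (pairing_subgroup A B)
          (period_sum om u c) (period_sum om u' c')].
Proof.
have [detG G1 GM invG _] := congG; have [sA iA] := invA.
have cS := orbits_countable orbS.
have sAB := @subgroup_pairing R _ A B.
have UH w : U w -> upper_half_plane w by rewrite defU => -[].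
have US w : U w -> ~ S w by rewrite defU => -[].
have cH : convex (@upper_half_plane R).
  move=> x y t; rewrite /upper_half_plane /= => x0 y0 t01.
  rewrite (segmentE x y t).2.
  have [t0|t0] := ltP 0 t; last by (have -> : t = 0 by lra); lra.
  by apply: ltr_wpDl; [apply: mulr_ge0; lra | exact: mulr_gt0].
have oH : square_open (@upper_half_plane R).
  move=> w w0; exists (complex.Im w) => // x [_].
  by rewrite ltr_norml /upper_half_plane /=; lra.
have detR g : G g -> \det (toR R g) = 1 by move=> Gg; rewrite det_map_mx detG.
have gU g w : G g -> U w -> U (mobius (toR R g) w).
  move=> Gg Uw; have Hw := UH _ Uw; rewrite defU; split; first exact: mobius_upper (detR _ Gg) Hw.
  move: (orbS) => [T [_ TH SE]]; rewrite SE => -[g' Gg' [s Ts gs]]; apply: (US _ Uw).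
  rewrite SE; exists (invmx g *m g'); first exact/GM/Gg'/invG.
  exists s => //; have Hs := TH _ Ts.
  rewrite map_mxM mobiusM ?detR ?gs //; [|exact/invG..].
  rewrite -mobiusM ?detR //; last exact/invG.
  by rewrite -map_mxM mulVmx ?map_mx1 ?mobius1 // unitmxE detG // unitr1.
split=> [I n g u c intI|I I' intI intI'|].
- by apply: period_sum_congr; eauto; exact: invariant_integral_primitive.
- have [UI eqI] := invariant_integral_primitive intI.
  have [UI' eqI'] := invariant_integral_primitive intI'.
  rewrite /congr_mod -pairingBl; set p := I z - I' z.
  (* The elements whose pairing with [p] lies in [(A, B)] form a subgroup, so the minimality in
     [H0_trivial] reduces the claim to the generators [g u - u]. *)
  apply: (H0_v [set w | pairing_subgroup A B (pairing p w)]); split.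
    split=> [|x y xP yP] /=.
      by rewrite -(subrr (0 : Vpoly R _)) pairingBr subrr; exact: subgroup0.
    by rewrite pairingBr; exact: (subgroupB sAB).
  move=> _ [g Gg [u Bu <-]] /=; rewrite pairing_coboundary ?detG //.
  apply: pairing_subgroupP => //; rewrite /p actB.
  have Ugz := gU _ _ (invG _ Gg) Uz.
  (* Invariance identifies [g^-1 p] with the difference of the two integrals at [g^-1 z], and
     uniqueness of primitives identifies that with the difference at [z]. *)
  apply: (@congr_mod_trans _ A sA (I (mobius (toR R (invmx g)) z) - I' (mobius (toR R (invmx g)) z))).
    by apply: congr_modB => //; apply: congr_mod_sym => //; [apply: eqI | apply: eqI'] => //; exact: invG.
  move: UI UI' Ugz Uz; rewrite defU => UI UI' Ugz Uz'.
  exact: primitive_unique sA cH oH cS UI UI' Ugz Uz'.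
suff [I PI] : exists I, equivariant_primitive G U A om I.
  move=> n g u c n' g' u' c' rep pth rep' pth'.
  apply: (@congr_mod_trans _ _ sAB (pairing (I z) v)); first apply: (congr_mod_sym sAB).
    by apply: period_sum_congr; eauto.
  by apply: period_sum_congr; eauto.
have loc w : upper_half_plane w -> exists2 e, 0 < e & has_primitive A S (eval_form om) (square w e).
  move=> Hw; have [e e0 He] := orbits_discrete detG orbS Hw.
  have [Sw|nSw] := pselect (S w).
    exists e => //; apply: (puncture_primitive sA cS smooth_om closed_om e0) => //; last exact: loops_om.
    by move=> x xw xNw; rewrite defU; split; [exact: (He x xw).1 | move=> /(He x xw).2].
  (* The only point of [S] that the square could contain is its centre, which is not in [S]. Halving
     the radius provides the margin consumed by the Poincare lemma. *)
  exists (e / 2); first lra.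
  apply: (square_has_primitive S smooth_om closed_om) => // x xw; rewrite defU; split.
    exact: (He x xw).1.
  by move=> /[dup] /(He x xw).2 ->.
have [I0 HI0] : has_primitive A S (eval_form om) (@upper_half_plane R).
  have := @rect_primitive R _ A S (eval_form om) sA cS (fun=> True) (fun y => 0 < y).
  move=> rp; apply: has_primitive_sub (rp _ _ _ _ _) => [w w0|x _|y y0|x y w|x y w x0 y0|w [_ w0]] //.
  - by exists 1.
  - exists y => // x'; rewrite ltr_norml; lra.
  - by move=> *; lra.
  - exact: loc.
have [a [phi [Ua per [p cob]]]] := H1_om.
(* The constant makes [I a] equal to [p], whose coboundary is the period cocycle modulo [A]; then
   [I (g a)] is congruent to [p + (g p - p)], that is, to [g (I a)]. *)
pose I w := I0 w + (p - I0 a).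
have UI : primitive_mod A U (eval_form om) I.
  by rewrite defU; exact: primitive_modD.
exists I; split=> // g w Gg Uw.
have Ia : I a = p by rewrite /I addrC subrK.
have base : congr_mod A (I (mobius (toR R g) a)) (act (toR R g) (I a)).
  have [s ps phis] := per g Gg.
  have H1 := path_integral_primitive sA (smooth_form_continuous smooth_om) ps UI.
  have H2 := congr_mod_trans sA (congr_mod_trans sA H1 (congr_mod_sym sA phis)) (cob g Gg).
  move: H2; rewrite /congr_mod Ia opprB addrA subrK; exact.
(* Invariance at the base point [a] spreads to [w] along the broken line [a, m0, w], each half being
   traversed towards [m0]. *)
have [m0 Hm] : exists m0, forall t, 0 <= t <= 1 -> U (segment a m0 t) /\ U (segment w m0 t).
  by move: Ua Uw; rewrite defU => Ua Uw; exact: broken_line cH oH cS Ua Uw.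
have dseg x t : exists d, cderiv (segment x m0) t d.
  by exists (m0 - x); exact: cderiv_segment.
have arc := equivariance_along_arc UH (fun z => gU g z Gg) invA equiv_om Gg (detG g Gg) UI.
have := arc _ (fun t t01 => (Hm t t01).1) (dseg a).
have := arc _ (fun t t01 => (Hm t t01).2) (dseg w).
rewrite !segment0 !segment1 => mw ma.
have H := congr_mod_trans sA (congr_mod_sym sA mw) ma.
have := subgroupD sA H base; rewrite subrK; exact.
Qed.
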